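(* Let $p > 7$ be a prime with $p \equiv 2$ or $3 \pmod 5$. Then $|\mathrm{Solv}(\mathrm{PSL}(2, p))|$ equals: (1) $\frac{5}{2}p^2 + \frac{5}{2}p + 2$ if $p \equiv 1 \pmod{24}$; (2) $2p^2 + p + 2$ if $p \equiv 5 \pmod{24}$; (3) $\frac{5}{2}p^2 + \frac{1}{2}p + 2$ if $p \equiv 7 \pmod{24}$; (4) $2p^2 + 2$ if $p \equiv 11 \pmod{24}$; (5) $2p^2 + 2p + 2$ if $p \equiv 13 \pmod{24}$; (6) $\frac{5}{2}p^2 + \frac{3}{2}p + 2$ if $p \equiv 17 \pmod{24}$; (7) $2p^2 + p + 2$ if $p \equiv 19 \pmod{24}$; (8) $\frac{5}{2}p^2 - \frac{1}{2}p + 2$ if $p \equiv 23 \pmod{24}$.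
   Context: For a finite group $G$ and $x \in G$, the solvabilizer of $x$ in $G$ is $\mathrm{Sol}_G(x) = \{y \in G : \langle x, y \rangle \text{ is solvable}\}$. $\mathrm{Solv}(G) = \{\mathrm{Sol}_G(x) : x \in G\}$ is the set of distinct solvabilizers of elements of $G$, and $|\mathrm{Solv}(G)|$ is its cardinality. *)

(* Defs.v *)
From HB Require Import structures.
From mathcomp Require Import all_boot all_order all_algebra all_fingroup all_solvable.
Set Implicit Arguments. Unset Strict Implicit. Unset Printing Implicit Defensive.
Import GRing.Theory.

Local Open Scope group_scope.

Definition SLset (p : nat) : {set {'GL_2(p)}} :=
  [set g : {'GL_2(p)} | (\det (GLval g) == 1)%R].

Lemma SLset_group_set (p : nat) : group_set (SLset p).
Proof.
apply/group_setP; split; first by rewrite inE GL_1E det1.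
move=> x y; rewrite !inE GL_MxE det_mulmx => /eqP -> /eqP ->.
by rewrite mulr1.
Qed.

Canonical SL_group (p : nat) : {group {'GL_2(p)}} := Group (SLset_group_set p).

Definition PSL (p : nat) := (SL_group p / 'Z(SL_group p))%G.

Definition Sol (gT : finGroupType) (G : {set gT}) (x : gT) : {set gT} :=
  [set y in G | solvable <<[set x; y]>>].

Definition Solv (gT : finGroupType) (G : {set gT}) : {set {set gT}} :=
  [set Sol G x | x in G].

(* Main.v *)
Require Import Defs.
From mathcomp Require Import all_boot all_order all_algebra all_fingroup all_solvable.
From mathcomp Require Import all_field all_character.
From mathcomp Require Import zify ring.
Set Implicit Arguments. Unset Strict Implicit. Unset Printing Implicit Defensive.
Import GRing.Theory.
Local Open Scope group_scope.

(** Every nontrivial element [x] of PSL(2,p) lies in a unique cell, the image of the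
    centralizer of a nonzero trace-zero matrix [M]; according to [- \det M]
    being zero, a nonzero square or a nonsquare, the cell is unipotent
    (order p), a split torus (cyclic of order (p-1)/2) or a nonsplit torus (cyclic of
    order (p+1)/2), and there are p+1, p(p+1)/2 and p(p-1)/2 of them.  A minimal normal
    subgroup of a solvable subgroup [H] is either contained in a cell, so that [H]
    normalizes that cell, or is a Klein four-group.  In the latter case every element
    of [H] satisfies h^3 = 1 or h^4 = 1, so the solvabilizer of an element of order
    larger than 4 of a torus [T] consists of 'N(T) and of the Borel subgroups
    containing [T], and only depends on [T]; that of a nontrivial unipotent element is
    its Borel subgroup.  Conversely, the solvabilizer of [x] determines the cell of [x]
    and, for a torus, which of 2, 3, 4 or more than 4 the order of [x] is.  Hence a
    unipotent cell contributes one solvabilizer, and a torus of order n contributes one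
    plus the number of divisors of n among 2, 3 and 4. *)

(** What separates solvabilizers is symmetry: for [x] and [y] in [G], [y \in Sol G x] if and only if
    [x \in Sol G y]. Once the solvabilizers of unipotent elements and of generators of tori are
    known, an equality [Sol G x = Sol G x'] forces [x] and [x'] to normalize the same unipotent
    cells and the same nonsplit tori. This recovers the cell, except that two distinct nonsplit tori
    need an extra argument, since an involution also normalizes tori that do not contain it. The
    bound on [p] makes every torus have order at least 5, so that its generators have order larger
    than 4. The delicate comparison is order 3 against order 4 in one torus: both solvabilizers
    reach outside the normalizers of the torus and of its unipotent cells, through Klein
    four-groups. A word identity separates them, without determining either set. The group theory is
    done for an abstract group with a conjugation-stable partition, given the sizes and numbers of
    cells and four structural facts. The order of the group, the conjugacy of cells and the orders
    of their normalizers then follow by counting, and matrices serve only to check the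
    hypotheses. *)

Lemma card_disjoint_cover (I J : finType) (A : {set I}) (B : {set J}) (F : J -> {set I}) :
    (forall x, x \in A -> exists2 j, j \in B & x \in F j) ->
    (forall j, j \in B -> F j \subset A) ->
    (forall j k x, j \in B -> k \in B -> x \in F j -> x \in F k -> j = k) ->
  #|A| = (\sum_(j in B) #|F j|)%N.
Proof.
move=> covA sFA injF; rewrite -sum1_card.
under [RHS]eq_bigr => j _ do rewrite -sum1_card.
rewrite (exchange_big_dep (mem A)) /=; last first.
  by move=> j x Bj /(subsetP (sFA j Bj)).
apply: eq_bigr => x /covA[j Bj Fx].
rewrite (bigD1 j) /=; last by rewrite Bj.
rewrite big1 // => k /andP[/andP[Bk Fk]].
by rewrite (injF k j x) ?eqxx.
Qed.

Lemma card_fibers (aT rT : finType) (A : {set aT}) (f : aT -> rT) k :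
  (forall x, x \in A -> #|[set y in A | f y == f x]| = k) -> #|A| = (#|f @: A| * k)%N.
Proof.
move=> fibk; rewrite -sum_nat_const.
rewrite (@card_disjoint_cover _ _ A (f @: A) (fun s => [set y in A | f y == s])).
- by apply: eq_bigr => _ /imsetP[x Ax ->]; apply: fibk.
- by move=> x Ax; exists (f x); rewrite ?imset_f // inE Ax eqxx.
- by move=> s _; apply/subsetP => x; rewrite inE => /andP[].
- by move=> s t x _ _; rewrite !inE => /andP[_ /eqP <-] /andP[_ /eqP].
Qed.

Lemma big_disjoint_setU (J : finType) (X Y : {set J}) (F : J -> nat) : [disjoint X & Y] ->
  (\sum_(j in X :|: Y) F j = \sum_(j in X) F j + \sum_(j in Y) F j)%N.
Proof. by move=> dXY; rewrite -bigU //; apply: eq_bigl => j; apply: in_setU. Qed.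

Lemma eq_card_imset (aT rT rT' : finType) (A : {set aT}) (f : aT -> rT) (g : aT -> rT') :
  {in A &, forall x y, f x = f y <-> g x = g y} -> #|f @: A| = #|g @: A|.
Proof.
move=> fg; have [->|[a Aa]] := set_0Vmem A; first by rewrite !imset0 !cards0.
pose h s := g (odflt a [pick x in A | f x == s]).
have hf x : x \in A -> h (f x) = g x.
  move=> Ax; rewrite /h; case: pickP => [y /andP[Ay /eqP E]|/(_ x)] /=.
    exact/(fg y x Ay Ax).
  by rewrite Ax eqxx.
have -> : g @: A = h @: (f @: A).
  by rewrite -imset_comp; apply: eq_in_imset => x Ax /=; rewrite hf.
rewrite [RHS]card_in_imset // => _ _ /imsetP[x Ax ->] /imsetP[y Ay ->].
by rewrite !hf // => /(fg x y Ax Ay).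
Qed.

(** * Groups partitioned like PSL(2,p) *)

Section PartitionedGroup.

Variables (gT : finGroupType) (G : {group gT}) (p : nat).
(* The unipotent cells, the split tori and the nonsplit tori. *)
Variables (UU SS NN : {set {group gT}}).
Notation tori := (SS :|: NN).
Notation cells := (UU :|: tori).

Hypothesis p_pr : prime p.
Hypothesis p_gt7 : (7 < p)%N.
Hypothesis cell_sub : forall C, C \in cells -> C \subset G.
Hypothesis cell_cover : forall x, x \in G -> x != 1 ->
  exists2 C, C \in cells & x \in C.
Hypothesis cell_TI : forall C D x, C \in cells -> D \in cells ->
  x \in C -> x \in D -> x != 1 -> C = D.
Hypothesis conjU : forall C g, g \in G -> C \in UU -> (C :^ g)%G \in UU.
Hypothesis conjS : forall C g, g \in G -> C \in SS -> (C :^ g)%G \in SS.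
Hypothesis conjN : forall C g, g \in G -> C \in NN -> (C :^ g)%G \in NN.
Hypothesis cardU : forall C, C \in UU -> #|C| = p.
Hypothesis cardS : forall C, C \in SS -> (#|C| * 2)%N = p.-1.
Hypothesis cardN : forall C, C \in NN -> (#|C| * 2)%N = p.+1.
Hypothesis nbU : #|UU| = p.+1.
Hypothesis nbS : (#|SS| * 2)%N = (p * p.+1)%N.
Hypothesis nbN : (#|NN| * 2)%N = (p * p.-1)%N.
Hypothesis torus_cyclic : forall T, T \in tori -> cyclic T.
Hypothesis torus_norm : forall T g,
  T \in tori -> g \in 'N_G(T) -> g \notin T -> g ^+ 2 = 1.
(** A single configuration is enough: conjugacy of split tori and of unipotent cells carries it to
    all of them. *)
Hypothesis borel_ex : exists T U1 U2, [/\ T \in SS, U1 \in UU, U2 \in UU, U1 != U2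
  & T \subset 'N(U1) :&: 'N(U2)].
(** The element [y] permutes the involutions cyclically, [e] to [e * v] to [v] to [e]; with the
    four-group it generates an alternating group of degree 4. *)
Hypothesis klein_rotation : forall e v, e \in G -> v \in G ->
  #[e] = 2 -> #[v] = 2 -> commute e v -> e != v ->
  exists y, [/\ y \in G, e ^ y = e * v & v ^ y = e].

(** * Cells and the order of the group *)

Lemma cellU C : C \in UU -> C \in cells. Proof. by rewrite inE => ->. Qed.
Lemma cellS C : C \in SS -> C \in cells. Proof. by rewrite !inE => ->; rewrite orbT. Qed.
Lemma cellN C : C \in NN -> C \in cells. Proof. by rewrite !inE => ->; rewrite !orbT. Qed.
Lemma cellT C : C \in tori -> C \in cells. Proof. by rewrite !inE => ->; rewrite !orbT. Qed.

Lemma cell_conj C g : g \in G -> C \in cells -> (C :^ g)%G \in cells.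
Proof.
move=> Gg; rewrite !inE => /or3P[] h.
- by rewrite conjU.
- by rewrite conjS // orbT.
- by rewrite conjN // !orbT.
Qed.

(** 8, 9 and 10 are composite. From [p >= 11] the tori, of orders [(p - 1)/2] and [(p + 1)/2], have
    more than 4 elements. *)
Lemma p_gt10 : (10 < p)%N.
Proof.
have h q : prime q -> (7 < q)%N -> (10 < q)%N by do 11![case: q => [|q] //].
exact: h p_pr p_gt7.
Qed.

Lemma card_torus_gt T : T \in tori -> (4 < #|T|)%N.
Proof. have := p_gt10; rewrite inE => ? /orP[/cardS|/cardN]; lia. Qed.

Lemma cells_disjoint : [disjoint UU & tori] /\ [disjoint SS & NN].
Proof.
have dis (X Y : {set {group gT}}) m n : (forall C, C \in X -> #|C| * 2 = m)%N ->
    (forall C, C \in Y -> #|C| * 2 = n)%N -> m <> n -> [disjoint X & Y].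
  move=> hX hY mn; rewrite -setI_eq0; apply/eqP/setP => C; rewrite !inE.
  by apply/negP => /andP[/hX e1 /hY e2]; apply: mn; rewrite -e1.
have cardU2 C : C \in UU -> (#|C| * 2 = p * 2)%N by move=> /cardU ->.
have dSN : [disjoint SS & NN].
  by apply: dis cardS cardN _; move: p_gt7; clear; lia.
have dUS : [disjoint UU & SS].
  by apply: dis cardU2 cardS _; move: p_gt7; clear; lia.
have dUN : [disjoint UU & NN].
  by apply: dis cardU2 cardN _; move: p_gt7; clear; lia.
split=> //; rewrite -setI_eq0 setIUr (disjoint_setI0 dUS) (disjoint_setI0 dUN).
by rewrite setU0.
Qed.

Lemma odd_p : odd p.
Proof. by case: (even_prime p_pr) => // E; move: p_gt7; rewrite E. Qed.

(** The nonidentity elements are partitioned by the cells, so [|G| - 1] is the sum of the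
    [|C| - 1]. *)
Lemma cardG : (#|G| * 2 = p * (p.-1 * p.+1))%N.
Proof.
have sumc (X : {set {group gT}}) n : (forall C, C \in X -> #|C|.-1 = n) ->
    (\sum_(C in X) #|C^#| = #|X| * n)%N.
  move=> h; rewrite -sum_nat_const; apply: eq_bigr => C /h <-.
  by rewrite (cardsD1 1 C) group1.
have eqG : #|G^#| = (\sum_(C in cells) #|C^#|)%N.
  apply: card_disjoint_cover => [x|C CC|C D x CC DD].
  - rewrite !inE => /andP[nx Gx]; have [C CC Cx] := cell_cover Gx nx.
    by exists C => //; rewrite !inE nx.
  - exact/setSD/cell_sub.
  - by rewrite !inE => /andP[nx Cx] /andP[_ Dx]; apply: cell_TI nx.
have : #|G^#| = #|G|.-1 by rewrite (cardsD1 1 G) group1.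
have [dUT dSN] := cells_disjoint.
rewrite eqG !big_disjoint_setU // => h.
have pk : p = (p./2 * 2).+1 by have := odd_double_half p; rewrite odd_p; move: p_gt7; clear; lia.
(* With [p = 2k + 1] the tori have orders [k] and [k + 1], and there are [(2k + 1)(k + 1)] and
   [(2k + 1)k] of them, so that no halves remain. *)
move: (p./2) pk => k pk.
rewrite (sumc UU p.-1) in h; last by move=> C /cardU ->.
rewrite (sumc SS k.-1) in h; last by move=> C /cardS; rewrite pk; clear; lia.
rewrite (sumc NN k) in h; last by move=> C /cardN; rewrite pk; clear; lia.
have := cardG_gt0 G; move: p_gt7 nbS nbN h; rewrite nbU pk /= => k3 n1 n2 h.
have {n1}n1 : #|SS| = (k.*2.+1 * k.+1)%N 
  by apply/eqP; rewrite -(eqn_pmul2r (ltn0Sn 1)) n1; apply/eqP; clear; lia.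
have {n2}n2 : #|NN| = (k.*2.+1 * k)%N 
  by apply/eqP; rewrite -(eqn_pmul2r (ltn0Sn 1)) n2; apply/eqP; clear; lia.
rewrite {}n1 {}n2 in h; case: k k3 {pk} h => [|k] //= _ h.
move: h; move: #|G| => [|g] //= h _; move: h; clear; lia.
Qed.

(** * Centralizers, normalizers and conjugacy of tori *)

Lemma cell_cent C x : C \in cells -> x \in C -> x != 1 -> 'C_G[x] \subset 'N(C).
Proof.
move=> CC Cx nx; apply/subsetP => g /setIP[Gg /cent1P cgx].
rewrite inE; suff -> : C :^ g = C by [].
have := cell_conj Gg CC => CgC.
have Cgx : x \in (C :^ g)%G.
  by have := memJ_conjg C g x; rewrite (conjg_fixP _) ?Cx //; apply/commgP.
by rewrite -[in RHS](cell_TI CgC CC Cgx Cx nx).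
Qed.

(** Both [g] and [t * g] normalize [T] without lying in it, so both square to 1; comparing the two
    relations gives inversion. *)
Lemma torus_invert T g t : T \in tori -> g \in 'N_G(T) -> g \notin T ->
  t \in T -> t ^ g = t^-1.
Proof.
move=> TT Ng nTg Tt.
have g2 := torus_norm TT Ng nTg.
have Gt := subsetP (cell_sub (cellT TT)) _ Tt.
have : (t * g) ^+ 2 = 1.
  apply: (torus_norm TT); last by rewrite groupMl.
  by rewrite groupM // inE Gt (subsetP (normG T)).
rewrite expgS expg1 => h; apply: (mulgI t); rewrite mulgV -h /conjg !mulgA.
by have -> : g^-1 = g by apply: (mulgI g); rewrite mulgV -g2.
Qed.

Lemma torus_big T : T \in tori -> exists2 t, t \in T & T :=: <[t]>.
Proof. by move=> /torus_cyclic/cyclicP[t Et]; exists t; rewrite ?Et ?cycle_id. Qed.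

(** An element centralizing [x] normalizes [T]; outside [T] it would invert [x] as well as fix
    it. *)
Lemma torus_cent T x : T \in tori -> x \in T -> x ^+ 2 != 1 -> 'C_G[x] \subset T.
Proof.
move=> TT Tx nx2; apply/subsetP => g Cg; apply/negPn/negP => nTg.
have nx : x != 1 by apply: contraNneq nx2 => ->; rewrite expg1n.
have Ng : g \in 'N_G(T).
  by rewrite inE (subsetP (cell_cent (cellT TT) Tx nx)) // (subsetP (subsetIl _ _) _ Cg).
have := torus_invert TT Ng nTg Tx.
case/setIP: Cg => _ /cent1P cgx.
rewrite /conjg -cgx mulKg => E; case/negP: nx2; by rewrite expg2 {1}E mulVg.
Qed.

Lemma torus_exp (T : {group gT}) n t : T :=: <[t]> -> T \in tori ->
  (0 < n)%N -> (n < 5)%N -> t ^+ n != 1.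
Proof.
move=> ET TT n0 n5; rewrite -order_dvdn; apply/negP => /(dvdn_leq n0) h.
have := card_torus_gt TT; rewrite ET ltnNge => /negP; apply.
exact: leq_trans h _.
Qed.

(** Two elements of the normalizer outside [T] both invert a generator, so their quotient
    centralizes it and lies in [T]: at most two cosets occur. *)
Lemma card_torus_norm T : T \in tori -> (#|'N_G(T)| <= #|T| * 2)%N.
Proof.
move=> TT; have [t Tt ET] := torus_big TT.
case: (boolP ('N_G(T) \subset T)) => [/subset_leq_card|/subsetPn[g Ng nTg]]; first lia.
have : 'N_G(T) \subset T :|: T :* g.
  apply/subsetP => h Nh; rewrite inE; case: (boolP (h \in T)) => //= nTh.
  rewrite mem_rcoset; have : h * g^-1 \in 'C_G[t].
    have Gh : h * g^-1 \in G.
      by move: Ng Nh; rewrite !inE => /andP[Gg _] /andP[Gh _]; rewrite groupM ?groupV.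
    rewrite inE Gh; apply/cent1P/commute_sym; apply/commgP; apply/conjg_fixP.
    rewrite conjgM (torus_invert TT Nh nTh Tt).
    apply: (canLR (conjgK g)); by rewrite (torus_invert TT Ng nTg Tt).
  by apply/subsetP; apply: torus_cent; rewrite ?(torus_exp ET TT).
move/subset_leq_card/leq_trans; apply.
by rewrite (leq_trans (leq_card_setU _ _)) // card_rcoset muln2 addnn.
Qed.

(* ['N_G(T)] has order at most [2 #|T|], so the orbit of [T] fills [XX]. *)
Lemma torus_transitive (XX : {set {group gT}}) (T : {group gT}) :
    (forall C g, g \in G -> C \in XX -> (C :^ g)%G \in XX) ->
    T \in XX -> T \in tori -> (#|XX| * (#|T| * 2) = #|G|)%N ->
  #|'N_G(T)| = (#|T| * 2)%N /\
  forall D, D \in XX -> exists2 g, g \in G & D = (T :^ g)%G.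
Proof.
move=> conjX XT TT cardX.
have sOX : orbit 'JG%act G T \subset XX.
  by apply/subsetP => _ /orbitP[g Gg <-]; apply: conjX.
have cO := card_orbit_stab 'JG%act G T; rewrite astab1JG in cO.
have leN := card_torus_norm TT.
have leO := subset_leq_card sOX.
have T0 : (0 < #|T| * 2)%N by rewrite muln_gt0 cardG_gt0.
have X0 : (0 < #|XX|)%N by apply/card_gt0P; exists T.
have eN : #|'N_G(T)| = (#|T| * 2)%N.
  apply/eqP; rewrite eqn_leq leN /= -(leq_pmul2l X0) cardX -cO.
  by rewrite leq_mul2r leO orbT.
split=> // D XD; have eO : orbit 'JG%act G T = XX.
  apply/eqP; rewrite eqEcard sOX /= -(leq_pmul2r T0) cardX -cO eN.
  by rewrite leq_mul2r leqnn orbT.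
by move: XD; rewrite -eO => /orbitP[g Gg <-]; exists g.
Qed.

Lemma cardG_S T : T \in SS -> (#|SS| * (#|T| * 2) = #|G|)%N.
Proof. by move=> /cardS ->; move: nbS cardG; clear; nia. Qed.

Lemma cardG_N T : T \in NN -> (#|NN| * (#|T| * 2) = #|G|)%N.
Proof. by move=> /cardN ->; move: nbN cardG; clear; nia. Qed.

Lemma split_transitive T D : T \in SS -> D \in SS ->
  exists2 g, g \in G & D = (T :^ g)%G.
Proof.
move=> ST SD; have TT : T \in tori by rewrite inE ST.
by have [_] := torus_transitive conjS ST TT (cardG_S ST); apply.
Qed.

Lemma nonsplit_transitive T D : T \in NN -> D \in NN ->
  exists2 g, g \in G & D = (T :^ g)%G.
Proof.
move=> NT ND; have TT : T \in tori by rewrite inE NT orbT.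
by have [_] := torus_transitive conjN NT TT (cardG_N NT); apply.
Qed.

Lemma torus_norm_card T : T \in tori -> #|'N_G(T)| = (#|T| * 2)%N.
Proof.
move=> TT; case/setUP: (TT) => h.
  by case: (torus_transitive conjS h TT (cardG_S h)).
by case: (torus_transitive conjN h TT (cardG_N h)).
Qed.

Lemma torus_inverter T : T \in tori -> exists2 v, v \in 'N_G(T) & v \notin T.
Proof.
move=> TT; apply/subsetPn/negP => /subset_leq_card.
by rewrite torus_norm_card // muln2 -addnn -{3}[#|T|]addn0 leq_add2l leqNgt cardG_gt0.
Qed.

(** * Unipotent cells and Borel subgroups *)

Lemma unip_Sylow U : U \in UU -> p.-Sylow(G) U.
Proof.
move=> UUU; have sUG := cell_sub (cellU UUU).
rewrite /pHall sUG /= /pgroup cardU // pnat_id //= p'natE //.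
have := Lagrange sUG; have := cardG; rewrite (cardU UUU) => e1 e2.
have {e1 e2} e : (#|G : U| * 2 = p.-1 * p.+1)%N.
  by move: e1 e2 p_gt7; clear; nia.
apply/negP => pd.
have : (p %| p.-1 * p.+1)%N by rewrite -e dvdn_mulr.
rewrite Euclid_dvdM // => /orP[/dvdn_leq|]; first by move: p_gt7; clear; lia.
by rewrite -addn1 dvdn_addr // dvdn1; move: p_gt7; clear; lia.
Qed.

Lemma unip_transitive U V : U \in UU -> V \in UU ->
  exists2 g, g \in G & V = (U :^ g)%G.
Proof.
move=> UU_U UU_V.
have [g Gg E] := Sylow_trans (unip_Sylow UU_U) (unip_Sylow UU_V).
by exists g => //; apply: val_inj.
Qed.

Lemma card_borel U : U \in UU -> (#|'N_G(U)| * 2 = p * p.-1)%N.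
Proof.
move=> UU_U.
have eO : orbit 'JG%act G U = UU.
  apply/setP => V; apply/orbitP/idP => [[g Gg <-]|UU_V]; first exact: conjU.
  by have [g Gg ->] := unip_transitive UU_U UU_V; exists g.
have := card_orbit_stab 'JG%act G U; rewrite astab1JG eO nbU.
by move: cardG; clear; nia.
Qed.

(** [U] is a normal Sylow subgroup of its normalizer, hence contains every p-element that normalizes
    it. *)
Lemma unip_borel U V x : U \in UU -> V \in UU -> x \in V -> x != 1 ->
  x \in 'N(U) -> U = V.
Proof.
move=> UU_U UU_V Vx nx Nx.
have Gx := subsetP (cell_sub (cellU UU_V)) _ Vx.
have sylU : p.-Sylow('N_G(U)) U.
  apply: pHall_subl (unip_Sylow UU_U); last exact: subsetIl.
  by rewrite subsetI (cell_sub (cellU UU_U)) normG.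
have nU : U <| 'N_G(U) by rewrite normalSG // (cell_sub (cellU UU_U)).
apply: (cell_TI (cellU UU_U) (cellU UU_V) _ Vx nx).
have NGx : x \in 'N_G(U) by rewrite inE Gx.
rewrite (mem_normal_Hall sylU nU NGx).
by apply: mem_p_elt Vx; case/and3P: (unip_Sylow UU_V).
Qed.

(** The order of [t] divides [|T| = (p + 1)/2], hence is prime to [p], and divides
    [|'N_G(U)| = p (|T| - 1)]; so it divides two consecutive integers. *)
Lemma nonsplit_borel T U t : T \in NN -> U \in UU -> t \in T ->
  t \in 'N(U) -> t = 1.
Proof.
move=> NT UU_U Tt Nt; apply/eqP; rewrite -order_eq1 -dvdn1.
have Gt := subsetP (cell_sub (cellN NT)) _ Tt.
have d1 : (#[t] %| #|T|)%N by apply: order_dvdG.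
have d2 : (#[t] %| #|'N_G(U)|)%N by apply: order_dvdG; rewrite inE Gt.
have {d2} d2 : (#[t] %| p * #|T|.-1)%N.
  suff <- : #|'N_G(U)| = (p * #|T|.-1)%N by [].
  by move: (card_borel UU_U) (cardN NT) p_gt7; clear; nia.
have cop : coprime #[t] p.
  rewrite coprime_sym prime_coprime //; apply/negP => /dvdn_trans/(_ d1).
  by move=> /(dvdn_leq (cardG_gt0 _)); move: (cardN NT) p_gt7; clear; lia.
rewrite Gauss_dvdr // in d2.
by move: d1; rewrite -[#|T|]prednK // -addn1 dvdn_addr.
Qed.

Lemma split_unip T : T \in SS -> exists U V, [/\ U \in UU, V \in UU, U != V,
  T \subset 'N(U) & T \subset 'N(V)].
Proof.
move=> ST; have [T0 [U [V [ST0 UU_U UU_V nUV]]]] := borel_ex.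
rewrite subsetI => /andP[nU nV].
have [g Gg ->] := split_transitive ST0 ST.
exists (U :^ g)%G, (V :^ g)%G; split; rewrite ?conjU // ?normJ ?conjSg //.
by apply: contra nUV => /eqP/congr_group/conjsg_inj/val_inj ->.
Qed.

Lemma unip_split U : U \in UU -> exists2 T, T \in SS & T \subset 'N(U).
Proof.
move=> UU_U; have [T [V [W [ST UU_V _ _]]]] := borel_ex.
rewrite subsetI => /andP[nV _].
have [g Gg ->] := unip_transitive UU_V UU_U.
by exists (T :^ g)%G; rewrite ?conjS // normJ conjSg.
Qed.

Lemma borel_sdprod T U : T \in SS -> U \in UU -> T \subset 'N(U) ->
  U ><| T = 'N_G(U).
Proof.
move=> ST UU_U nUT.
have tiUT : U :&: T = 1.
  apply: coprime_TIg; rewrite (cardU UU_U) prime_coprime //.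
  by apply/negP => /(dvdn_leq (cardG_gt0 _)); move: (cardS ST) p_gt7; clear; lia.
rewrite sdprodE //; apply/eqP; rewrite eqEcard; apply/andP; split.
  by rewrite mul_subG // subsetI ?normG ?nUT ?(cell_sub (cellU UU_U)) ?(cell_sub (cellS ST)).
rewrite TI_cardMg // (cardU UU_U) -(leq_pmul2r (ltn0Sn 1)) -mulnA.
by rewrite (card_borel UU_U) (cardS ST).
Qed.

Lemma borel_der U : U \in UU -> 'N_G(U)^`(1) \subset U.
Proof.
move=> UU_U; have [T ST nUT] := unip_split UU_U.
have sd := borel_sdprod ST UU_U nUT.
apply: der1_min; first by rewrite subsetIr.
have /isog_abelian <- := sdprod_isog sd.
by apply/cyclic_abelian/torus_cyclic; rewrite inE ST.
Qed.

Lemma borel_sol U : U \in UU -> solvable 'N_G(U).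
Proof.
move=> UU_U; have sU : solvable U.
  by apply/abelian_sol/cyclic_abelian/prime_cyclic; rewrite (cardU UU_U).
have nU : U <| 'N_G(U) by rewrite normalSG // (cell_sub (cellU UU_U)).
rewrite (series_sol nU) sU abelian_sol //.
exact/sub_der1_abelian/borel_der.
Qed.

Lemma unip_exp U u n : U \in UU -> u \in U -> u != 1 -> (0 < n)%N ->
  (n < 5)%N -> u ^+ n != 1.
Proof.
move=> UU_U Uu nu n0 n5.
have pu : #[u] = p.
  have := order_dvdG Uu; rewrite (cardU UU_U) => /(primeP p_pr).2/orP[|/eqP //].
  by rewrite order_eq1 (negPf nu).
rewrite -order_dvdn pu; apply/negP => /(dvdn_leq n0).
by move: p_gt7 n5; clear; lia.
Qed.

(** If a nontrivial [c] centralizing [u] lay in a torus, [u] would normalize that torus, hence lie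
    in it or square to 1. The first makes the torus equal to [U], the second contradicts the order
    [p] of [u]. If [c] lies in a unipotent cell, that cell is [U]. *)
Lemma unip_cent U u : U \in UU -> u \in U -> u != 1 -> 'C_G[u] \subset U.
Proof.
move=> UU_U Uu nu; apply/subsetP => c Cc.
have /setIP[Gc cuc] := Cc.
have Nc := subsetP (cell_cent (cellU UU_U) Uu nu) _ Cc.
have [->|nc] := eqVneq c 1; first exact: group1.
have [C CC xC] := cell_cover Gc nc.
case/setUP: (CC) => [UU_C|TC].
  by rewrite (unip_borel UU_U UU_C xC nc Nc).
have Gu := subsetP (cell_sub (cellU UU_U)) _ Uu.
have NCu : u \in 'N_G(C).
  rewrite inE Gu; apply: (subsetP (cell_cent CC xC nc)).
  by rewrite inE Gu cent1C.
have [Cu|nCu] := boolP (u \in C).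
  by rewrite (cell_TI (cellU UU_U) CC Uu Cu nu).
have u2 := torus_norm TC NCu nCu.
by move: (unip_exp UU_U Uu nu (n := 2) isT isT); rewrite u2 eqxx.
Qed.

(** [<[t]>] is a p'-subgroup of the Borel subgroup, so Hall's theorem conjugates it into a
    complement [T0] which is itself a split torus. Then [T :^ g] and [T0] share a nontrivial element
    and coincide. *)
Lemma split_borel T U t : T \in SS -> U \in UU -> t \in T -> t != 1 ->
  t \in 'N(U) -> T \subset 'N(U).
Proof.
move=> ST UU_U Tt nt Nt; have [T0 ST0 nUT0] := unip_split UU_U.
have sd := borel_sdprod ST0 UU_U nUT0.
have Gt := subsetP (cell_sub (cellS ST)) _ Tt.
have p'T D : D \in SS -> p^'.-group D.
  move=> SD; rewrite /pgroup p'natE //.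
  by apply/negP => /(dvdn_leq (cardG_gt0 _)); move: (cardS SD) p_gt7; clear; lia.
have pT0 : p^'.-Hall('N_G(U)) T0.
  have [/= nU sT0 _ _ _] := sdprod_context sd.
  rewrite /pHall sT0 p'T // -divgS // -(sdprod_card sd) mulnK ?cardG_gt0 //.
  by rewrite (cardU UU_U) pnatNK pnat_id.
have [||g Ng] := Hall_Jsub (borel_sol UU_U) pT0 (_ : <[t]> \subset _) _.
- by rewrite cycle_subG inE Gt.
- by apply: pgroupS (p'T T ST); rewrite cycle_subG.
rewrite -cycleJ cycle_subG => T0tg.
have /setIP[Gg NUg] := Ng.
have Ttg : t ^ g \in (T :^ g)%G by rewrite memJ_conjg.
have ntg : t ^ g != 1 by rewrite conjg_eq1.
have E := cell_TI (cellS (conjS Gg ST)) (cellS ST0) Ttg T0tg ntg.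
by rewrite -(conjSg _ _ g) -normJ (normP NUg) (congr_group E).
Qed.

(** The commutator of [x] with a generator [t] of [T] lies in the derived subgroups of both Borel
    subgroups, hence in [U] and in [V], and is trivial; thus [x] centralizes [t]. *)
Lemma borel_meet T U V : T \in SS -> U \in UU -> V \in UU -> U != V ->
  T \subset 'N(U) -> T \subset 'N(V) -> 'N_G(U) :&: 'N_G(V) \subset T.
Proof.
move=> ST UU_U UU_V nUV nUT nVT; apply/subsetP => x /setIP[Nx NVx].
have TT : T \in tori by rewrite inE ST.
have sTG := cell_sub (cellS ST).
have [t Tt ET] := torus_big TT.
have abD : commute x t.
  have cN W : W \in UU -> x \in 'N_G(W) -> T \subset 'N(W) -> [~ x, t] \in W.
    move=> UU_W NWx nWT; apply: (subsetP (borel_der UU_W)).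
    apply: mem_commg => //; rewrite inE (subsetP sTG) //; exact: (subsetP nWT).
  apply/commgP; apply: contraR nUV => nxt.
  have := cell_TI (cellU UU_U) (cellU UU_V) (cN U UU_U Nx nUT) (cN V UU_V NVx nVT).
  by move=> ->.
apply: (subsetP (torus_cent TT Tt (torus_exp (n := 2) ET TT isT isT))).
by case/setIP: Nx => Gx _; rewrite inE Gx; apply/cent1P.
Qed.

(** * Commuting elements and Klein four-groups *)

Lemma torus_cycle_eq T x y : T \in tori -> x \in T -> y \in T ->
  #[x] = #[y] -> <[x]> = <[y]>.
Proof.
move=> TT Tx Ty exy; have [t _ ET] := torus_big TT.
have := eq_subG_cyclic (torus_cyclic TT) (H := <[x]>) (K := <[y]>).
by rewrite !cycle_subG -![#|_|]/(#[_]) exy => /(_ Tx Ty); rewrite eqxx => /eqP.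
Qed.

Lemma torus_cent_invol T x g : T \in tori -> x \in T -> x != 1 -> g \in 'C_G[x] ->
  g \notin T -> x ^+ 2 = 1.
Proof.
move=> TT Tx nx Cg nTg; apply/eqP/negPn/negP => nx2.
by case/negP: nTg; apply: (subsetP (torus_cent TT Tx nx2)).
Qed.

(** This is the origin of the Klein four-groups: commuting elements of distinct cells must be
    involutions. Unipotent centralizers stay in the cell, so [C] is a torus, and [y] normalizes it
    from outside. *)
Lemma comm_cell_invol x y C : x \in G -> y \in G -> commute x y -> x != 1 ->
  C \in cells -> x \in C -> y \notin C -> [/\ C \in tori, #[x] = 2 & #[y] = 2].
Proof.
move=> Gx Gy cxy nx CC Cx nCy.
have Cgy : y \in 'C_G[x] by rewrite inE Gy; apply/cent1P.
have TC : C \in tori.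
  case/setUP: CC => // UU_C; case/negP: nCy.
  exact: (subsetP (unip_cent UU_C Cx nx)).
have Ny : y \in 'N_G(C) by rewrite inE Gy (subsetP (cell_cent CC Cx nx)).
have ny : y != 1 by apply: contraNneq nCy => ->; exact: group1.
split=> //; apply: nt_prime_order => //.
  exact: torus_cent_invol Cgy nCy.
exact: torus_norm Ny nCy.
Qed.

(** Let [C] be the torus of [e]. An element of [C] commuting with [v] is 1 or the only involution
    [e] of [C]. An element [g] outside [C] inverts [C], as [v] does, so the previous case applies to
    [g * v]. *)
Lemma klein_cent e v g : e \in G -> v \in G -> #[e] = 2 -> #[v] = 2 -> commute e v ->
  e != v -> g \in G -> commute g e -> commute g v -> g \in [set 1; e; v; e * v].
Proof.
move=> Ge Gv oe ov cev nev Gg cge cgv.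
have ne : e != 1 by rewrite -order_gt1 oe.
have nv : v != 1 by rewrite -order_gt1 ov.
have [C CC Ce] := cell_cover Ge ne.
have e2 : e ^+ 2 = 1 by rewrite -oe expg_order.
have v2 : v ^+ 2 = 1 by rewrite -ov expg_order.
have TC0 : C \in tori.
  case/setUP: CC => // UU_C.
  by move: (unip_exp UU_C Ce ne (n := 2) isT isT); rewrite e2 eqxx.
have nCv : v \notin C.
  apply/negP => Cv; case/negP: nev; apply/eqP.
  have := torus_cycle_eq TC0 Ce Cv; rewrite oe ov => /(_ erefl) E.
  have : e \in <[v]> by rewrite -E cycle_id.
  by rewrite cycle2g // !inE (negPf ne) => /eqP.
have key h : h \in G -> commute h e -> commute h v -> h \in C -> h \in [set 1; e].
  move=> Gh che chv Ch; rewrite !inE; have [//|nh /=] := eqVneq h 1.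
  have [_ oh _] := comm_cell_invol Gh Gv chv nh CC Ch nCv.
  have := torus_cycle_eq TC0 Ch Ce; rewrite oh oe => /(_ erefl) E.
  have : h \in <[e]> by rewrite -E cycle_id.
  by rewrite cycle2g // !inE (negPf nh).
have [Cg|nCg] := boolP (g \in C).
  by have := key g Gg cge cgv Cg; rewrite !inE => /orP[] ->; rewrite ?orbT.
have Ne h : h \in G -> commute h e -> h \in 'N_G(C).
  move=> Gh che; rewrite inE Gh (subsetP (cell_cent CC Ce ne)) // inE Gh.
  exact/cent1P.
have Cgv : g * v \in C.
  have [t Ct EC] := torus_big TC0.
  apply: (subsetP (torus_cent TC0 Ct (torus_exp (n := 2) EC TC0 isT isT))).
  rewrite inE groupM //; apply/cent1P/commute_sym; apply/commgP/conjg_fixP.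
  rewrite conjgM (torus_invert TC0 (Ne g Gg cge) nCg Ct) conjVg.
  by rewrite (torus_invert TC0 (Ne v Gv (commute_sym cev)) nCv Ct) invgK.
have : g * v \in [set 1; e].
  have c1 : commute (g * v) e := commute_sym (commuteM (commute_sym cge) cev).
  have c2 : commute (g * v) v := commute_sym (commuteM (commute_sym cgv) (erefl (v * v))).
  exact: key (groupM Gg Gv) c1 c2 Cgv.
rewrite !inE -(inj_eq (mulIg v)) -[X in _ || X](inj_eq (mulIg v)) -mulgA -expg2 v2.
by rewrite mulg1 mul1g => /orP[] ->; rewrite ?orbT.
Qed.

Definition klein (V : {group gT}) := [/\ V \subset G, #|V| = 4 & 2.-abelem V].

Lemma klein_gen e v : e \in G -> v \in G -> #[e] = 2 -> #[v] = 2 -> commute e v ->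
  e != v -> exists V, [/\ klein V, e \in V & v \in V].
Proof.
move=> Ge Gv oe ov cev nev.
have ne : e != 1 by rewrite -order_gt1 oe.
have nv : v != 1 by rewrite -order_gt1 ov.
have e2 : e ^+ 2 = 1 by rewrite -oe expg_order.
have v2 : v ^+ 2 = 1 by rewrite -ov expg_order.
have cev' : <[v]> \subset 'C(<[e]>) by rewrite cent_cycle cycle_subG; apply/cent1P.
have EV : <[e]> <*> <[v]> = <[e]> * <[v]> by rewrite cent_joinEr.
exists (<[e]> <*> <[v]>)%G; split=> /=.
- split=> /=.
  + by rewrite join_subG !cycle_subG Ge.
  + rewrite EV TI_cardMg -?[#|_|]/(#[_]) ?oe ?ov //.
    apply/trivgP/subsetP => x /setIP[] /=; rewrite !cycle2g // !inE.
    case/orP => [/eqP->|/eqP-> /orP[]]; rewrite ?eqxx // ?(negPf ne) //.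
    by rewrite (negPf nev).
  + rewrite abelemE //= EV abelianM !cycle_abelian cev' /=.
    apply/exponentP => _ /mulsgP[_ _ /cycleP[i ->] /cycleP[j ->] ->].
    by rewrite expgMn; [rewrite -!expgM !(mulnC _ 2) !expgM e2 v2 !expg1n mulg1
                       |apply/commuteX2].
- by rewrite mem_gen // inE cycle_id.
- by rewrite mem_gen // inE cycle_id orbT.
Qed.

Lemma klein_sq (V : {group gT}) w : klein V -> w \in V -> w ^+ 2 = 1.
Proof. by case=> _ _ /abelemP[] // _; apply. Qed.

Lemma klein_order (V : {group gT}) w : klein V -> w \in V -> w != 1 -> #[w] = 2.
Proof. by move=> kV Vw nw; apply: nt_prime_order => //; apply: klein_sq kV Vw. Qed.

Lemma klein_commute (V : {group gT}) a b : klein V -> a \in V -> b \in V -> commute a b.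
Proof. by case=> _ _ /abelem_abelian/centsP cV Va Vb; apply: cV. Qed.

Lemma klein_enum (V : {group gT}) a b : klein V -> a \in V -> b \in V ->
  a != 1 -> b != 1 -> a != b -> V :=: [set 1; a; b; a * b].
Proof.
move=> kV Va Vb na nb nab; case: (kV) => sVG cV _.
apply/eqP; rewrite eqEsubset andbC; apply/andP; split.
  by apply/subsetP => x; rewrite !inE -!orbA => /or4P[] /eqP->; rewrite // groupM.
apply/subsetP => x Vx; have sV := subsetP sVG.
by apply: klein_cent; rewrite ?(sV _ _) ?(klein_order kV) //; apply: (klein_commute kV).
Qed.

Lemma klein_self_cent (V : {group gT}) a b g : klein V -> a \in V -> b \in V ->
  a != 1 -> b != 1 -> a != b -> g \in G -> a ^ g = a -> b ^ g = b -> g \in V.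
Proof.
move=> kV Va Vb na nb nab Gg /conjg_fixP/commgP ca /conjg_fixP/commgP cb.
rewrite (klein_enum kV Va Vb na nb nab); case: (kV) => /subsetP sV _ _.
exact: (klein_cent (sV _ Va) (sV _ Vb) (klein_order kV Va na)
  (klein_order kV Vb nb) (klein_commute kV Va Vb) nab Gg (commute_sym ca)
  (commute_sym cb)).
Qed.

Lemma klein_other (V : {group gT}) a : klein V -> exists2 b, b \in V & (b != 1) && (b != a).
Proof.
case=> _ cV _; have : ~~ (V \subset [set 1; a]).
  by apply/negP => /subset_leq_card; rewrite cV cards2; case: (1 != a).
by case/subsetPn => b Vb; rewrite !inE negb_or; exists b.
Qed.

(** [h] fixes [a] and either fixes or swaps the other two involutions, so its square centralizes
    [V], which is its own centralizer in [G]. *)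
Lemma klein_fix (V : {group gT}) a h : klein V -> h \in 'N_G(V) -> a \in V -> a != 1 ->
  a ^ h = a -> h ^+ 2 \in V.
Proof.
move=> kV /setIP[Gh Nh] Va na fa.
have [b Vb /andP[nb nba]] := klein_other a kV.
have nab : a != b by rewrite eq_sym.
apply: (klein_self_cent kV Va Vb) => //; first exact: groupX.
  by rewrite expg2 conjgM !fa.
have Vbh : b ^ h \in V by rewrite memJ_norm.
have : b ^ h \in [set 1; a; b; a * b] by rewrite -(klein_enum kV Va Vb).
rewrite !inE conjg_eq1 (negPf nb) -{1}fa (inj_eq (conjg_inj h)) (negPf nba) /=.
rewrite expg2 conjgM => /orP[/eqP E|/eqP E]; first by rewrite !E.
by rewrite {1}E conjMg fa E mulgA -expg2 (klein_sq kV Va) mul1g.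
Qed.

(** [h] acts as a 3-cycle on the involutions, so [h ^+ 3] centralizes [V] and lies in it. But [h]
    fixes its own cube, which must then be trivial. *)
Lemma klein_nofix (V : {group gT}) h : klein V -> h \in 'N_G(V) ->
  (forall a, a \in V -> a != 1 -> a ^ h != a) -> h ^+ 3 = 1.
Proof.
move=> kV Nh nf; have /setIP[Gh NVh] := Nh.
have [a Va /andP[na _]] := klein_other 1 kV.
have Vah b : b \in V -> b ^ h \in V by move=> Vb; rewrite memJ_norm.
have nab : a != a ^ h by rewrite eq_sym nf.
have na1 : a ^ h != 1 by rewrite conjg_eq1.
have EV := klein_enum kV Va (Vah _ Va) na na1 nab.
have aa : (a ^ h) ^ h = a * a ^ h.
  have : (a ^ h) ^ h \in [set 1; a; a ^ h; a * a ^ h] by rewrite -EV; exact: Vah (Vah _ Va).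
  rewrite !inE !conjg_eq1 (negPf na) (inj_eq (conjg_inj h)) (negPf (nf _ Va na)) orbF /=.
  case/orP => /eqP // E; have := nf (a * a ^ h); rewrite groupM ?Vah //.
  rewrite conjMg E (klein_commute kV (Vah _ Va) Va) eqxx => /(_ isT) H.
  exfalso; have := H _; rewrite -eq_invg_mul => /(_ _)/negP; apply => //.
  have <- : a = a^-1; last by [].
  by apply: (mulgI a); rewrite mulgV -expg2 (klein_sq kV Va).
have a3 : ((a ^ h) ^ h) ^ h = a.
  by rewrite aa conjMg aa mulgA (klein_commute kV (Vah _ Va) Va) -mulgA -expg2
             (klein_sq kV (Vah _ Va)) mulg1.
have h3 : h ^+ 3 = h * h * h by rewrite !expgS mulg1 mulgA.
have Vh3 : h ^+ 3 \in V.
  apply: (klein_self_cent kV Va (Vah _ Va)) => //; first exact: groupX.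
    by rewrite h3 !conjgM.
  by rewrite h3 !conjgM a3.
apply/eqP/negPn/negP => nh3.
have := nf _ Vh3 nh3; rewrite conjXg conjgE mulKg; move/eqP; apply.
by [].
Qed.

(** If the abelian normal subgroup [E] lies in the cell [C] of [e], then [C] and its conjugate under
    [h] share [e ^ h], so [H] normalizes [C]. Otherwise some [v] in [E] outside [C] commutes with
    [e]; both are involutions, and the four-group they generate, being self-centralizing, is all of
    [E]. *)
Lemma solvable_classification (H : {group gT}) : H \subset G -> solvable H -> H :!=: 1 ->
  (exists2 C, C \in cells & H \subset 'N_G(C)) \/
  (exists2 V : {group gT}, klein V & H \subset 'N_G(V)).
Proof.
move=> sHG solH ntH.
have [E [sEH nEH ntE abE]] := solvable_norm_abelem solH (normal_refl H) ntH.
have nEH' := normal_norm nEH; case/is_abelemP: abE => r r_pr abE.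
have sEG := subset_trans sEH sHG.
have [e Ee ne] := trivgPn _ ntE.
have Ge := subsetP sEG _ Ee.
have [C CC Ce] := cell_cover Ge ne.
have [sEC|/subsetPn[v Ev nCv]] := boolP (E \subset C).
  left; exists C => //; rewrite subsetI sHG /=; apply/subsetP => h Hh.
  rewrite inE; have Gh := subsetP sHG _ Hh.
  have eh : e ^ h \in C by rewrite (subsetP sEC) // memJ_norm // (subsetP nEH').
  have eh' : e ^ h \in (C :^ h)%G by rewrite memJ_conjg.
  have neh : e ^ h != 1 by rewrite conjg_eq1.
  by rewrite -{2}(cell_TI (cell_conj Gh CC) CC eh' eh neh).
right; have Gv := subsetP sEG _ Ev.
have cE a b : a \in E -> b \in E -> commute a b.
  by have /centsP cEE := abelem_abelian abE; move=> Ea Eb; apply: cEE.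
have [_ oe ov] := comm_cell_invol Ge Gv (cE _ _ Ee Ev) ne CC Ce nCv.
have nev : e != v by apply: contraNneq nCv => <-.
have [V [kV Ve Vv]] := klein_gen Ge Gv oe ov (cE _ _ Ee Ev) nev.
have nv : v != 1 by rewrite -order_gt1 ov.
suff EV : E :=: V by exists V; rewrite // subsetI sHG -EV.
rewrite (klein_enum kV Ve Vv ne nv nev); apply/eqP; rewrite eqEsubset.
apply/andP; split.
  apply/subsetP => x Ex.
  exact: (klein_cent Ge Gv oe ov (cE _ _ Ee Ev) nev
    (subsetP sEG _ Ex) (cE _ _ Ex Ee) (cE _ _ Ex Ev)).
by apply/subsetP => x; rewrite !inE -!orbA => /or4P[] /eqP->; rewrite // groupM.
Qed.

(** * Solvabilizers of unipotent and of torus elements *)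

Lemma SolP x y : x \in G -> reflect (y \in G /\ solvable <<[set x; y]>>) (y \in Sol G x).
Proof. by move=> Gx; rewrite inE; apply: andP. Qed.

Lemma Sol_sub (H : {group gT}) x y : solvable H -> H \subset G -> x \in H -> y \in H ->
  y \in Sol G x.
Proof.
move=> solH sHG Hx Hy; rewrite inE (subsetP sHG) //=.
by apply: solvableS solH; rewrite gen_subG; apply/subsetP => z; rewrite !inE => /orP[] /eqP->.
Qed.

Lemma Sol_sym x y : x \in G -> (y \in Sol G x) -> (x \in Sol G y).
Proof. by move=> Gx; rewrite !inE Gx setUC => /andP[]. Qed.

Lemma Sol_cases x y : x \in G -> x != 1 -> y \in Sol G x ->
  (exists C, [/\ C \in cells, x \in 'N_G(C) & y \in 'N_G(C)]) \/
  (exists V, [/\ klein V, x \in 'N_G(V) & y \in 'N_G(V)]).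
Proof.
move=> Gx nx /(SolP _ Gx)[Gy solH].
have Hx : x \in <<[set x; y]>> by rewrite mem_gen // !inE eqxx.
have Hy : y \in <<[set x; y]>> by rewrite mem_gen // !inE eqxx orbT.
have ntH : <<[set x; y]>> != 1 by apply/trivgPn; exists x.
have sHG : <<[set x; y]>> \subset G.
  by rewrite gen_subG; apply/subsetP => z; rewrite !inE => /orP[] /eqP->.
by have [[C CC sH]|[V kV sH]] := solvable_classification sHG solH ntH;
  [left; exists C|right; exists V];
  split=> //; apply: (subsetP sH).
Qed.

(** A permutation of three involutions fixes one of them or is a 3-cycle. The membership
    [h ^+ 2 \in V] is kept for elements of order 4. *)
Lemma klein_norm_exp (V : {group gT}) h : klein V -> h \in 'N_G(V) ->
  (h ^+ 2 \in V) && (h ^+ 4 == 1) || (h ^+ 3 == 1).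
Proof.
move=> kV Nh; case: (boolP [exists a in V, (a != 1) && (a ^ h == a)]).
  case/exists_inP => a Va /andP[na /eqP fa].
  have Vh := klein_fix kV Nh Va na fa; rewrite Vh.
  by rewrite (expgM h 2 2) (klein_sq kV Vh) eqxx.
move/exists_inPn => nf; rewrite (klein_nofix kV Nh) ?eqxx ?orbT // => a Va na.
by have := nf a Va; rewrite na.
Qed.

Lemma Sol_unip U u y : U \in UU -> u \in U -> u != 1 ->
  (y \in Sol G u) = (y \in 'N_G(U)).
Proof.
move=> UU_U Uu nu; have sUG := cell_sub (cellU UU_U); have Gu := subsetP sUG _ Uu.
apply/idP/idP => [Sy|Ny]; last first.
  apply: (Sol_sub (borel_sol UU_U)); rewrite ?subsetIl //.
  by rewrite inE Gu (subsetP (normG U)).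
case: (Sol_cases Gu nu Sy) => [[C [CC Nu Ny]]|[V [kV Nu _]]].
  have Cu : u \in C.
    case/setUP: (CC) => [UU_C|TC].
      by case/setIP: Nu => _ Nu; rewrite (unip_borel UU_C UU_U Uu nu Nu).
    apply/negPn/negP => nCu; have := torus_norm TC Nu nCu.
    by move/eqP; rewrite (negPf (unip_exp UU_U Uu nu _ _)).
  by rewrite -(cell_TI CC (cellU UU_U) Cu Uu nu).
have := klein_norm_exp kV Nu.
by rewrite !(negPf (unip_exp UU_U Uu nu _ _)) // andbF.
Qed.

Lemma torus_norm_sol T : T \in tori -> solvable 'N_G(T).
Proof.
move=> TT; have nT : T <| 'N_G(T) by rewrite normalSG // (cell_sub (cellT TT)).
rewrite (series_sol nT) abelian_sol ?cyclic_abelian ?torus_cyclic //=.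
apply/abelian_sol/cyclic_abelian/prime_cyclic.
rewrite card_quotient ?normal_norm // -divgS ?normal_sub // torus_norm_card //.
by rewrite mulKn ?cardG_gt0.
Qed.

(** Every element has order dividing 12, the least common multiple of 3 and 4. By Cauchy only 2 and
    3 divide the order of the normalizer, and Burnside's theorem applies. *)
Lemma klein_norm_sol (V : {group gT}) : klein V -> solvable 'N_G(V).
Proof.
move=> kV; apply: Burnside_p_a_q_b; rewrite -[2]/(size [:: 2; 3]).
apply: uniq_leq_size; first exact: primes_uniq.
move=> q; rewrite mem_primes => /and3P[q_pr _ /(Cauchy q_pr)[h Nh oh]].
have : (q %| 12)%N.
  rewrite -oh order_dvdn; have := klein_norm_exp kV Nh.
  case/orP => [/andP[_ /eqP h4]|/eqP h3]; first by rewrite (expgM h 4 3) h4 expg1n.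
  by rewrite (expgM h 3 4) h3 expg1n.
rewrite -[12]/(2 * 2 * 3)%N !Euclid_dvdM // !dvdn_prime2 // !inE.
by case/orP => [/orP[]|] /eqP->.
Qed.

(** [x ^+ 2 != 1] excludes the elements that normalize a torus from outside it. If [x] normalizes a
    unipotent cell, then [T] is split and normalizes it entirely. *)
Lemma Sol_torus T x y : T \in tori -> x \in T -> x ^+ 2 != 1 -> y \in Sol G x ->
  [\/ y \in 'N_G(T), exists U, [/\ U \in UU, T \subset 'N(U) & y \in 'N_G(U)]
    | exists V, [/\ klein V, x \in 'N_G(V) & y \in 'N_G(V)]].
Proof.
move=> TT Tx nx2 Sy.
have nx : x != 1 by apply: contraNneq nx2 => ->; rewrite expg1n.
have Gx : x \in G by apply: subsetP Tx; apply: cell_sub (cellT TT).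
case: (Sol_cases Gx nx Sy) => [[C [CC Nx Ny]]|HV]; last by constructor 3.
case/setUP: (CC) => [UU_C|TC].
  constructor 2; exists C; split=> //; case/setIP: Nx => _ Nx.
  case/setUP: TT => [ST|NT]; first exact: split_borel Tx nx Nx.
  by rewrite (nonsplit_borel NT UU_C Tx Nx) eqxx in nx.
constructor 1; have [Cx|nCx] := boolP (x \in C).
  by rewrite -(cell_TI CC (cellT TT) Cx Tx nx).
by rewrite (torus_norm TC Nx nCx) eqxx in nx2.
Qed.

Lemma Sol_big T x y : T \in tori -> x \in T -> x ^+ 3 != 1 -> x ^+ 4 != 1 ->
  y \in Sol G x <->
  (y \in 'N_G(T) \/ exists U, [/\ U \in UU, T \subset 'N(U) & y \in 'N_G(U)]).
Proof.
move=> TT Tx x3 x4; have sTG := cell_sub (cellT TT).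
have Gx := subsetP sTG _ Tx.
have x2 : x ^+ 2 != 1 by apply: contraNneq x4 => E; rewrite (expgM x 2 2) E expg1n.
split=> [Sy|[Ny|[U [UU_U nUT Ny]]]].
- case: (Sol_torus TT Tx x2 Sy) => [|HU|[V [kV Nx _]]]; [by left|by right|].
  by have := klein_norm_exp kV Nx; rewrite (negPf x3) (negPf x4) andbF.
- apply: (Sol_sub (torus_norm_sol TT)); rewrite ?subsetIl //.
  by rewrite inE Gx (subsetP (normG T)).
- apply: (Sol_sub (borel_sol UU_U)); rewrite ?subsetIl //.
  by rewrite inE Gx (subsetP nUT).
Qed.

(** * Klein four-groups attached to elements of order 3 and 4 *)

Lemma torus_conj_dvd C D d : C \in tori -> D \in tori -> (1 < d)%N ->
  (d %| #|C|)%N -> (d %| #|D|)%N -> exists2 g, g \in G & D = (C :^ g)%G.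
Proof.
move=> TC TD d1 dC dD.
(* Split and nonsplit tori have consecutive orders, so a common divisor larger than 1 forces tori of
   the same type, which are conjugate. *)
have aux A B : A \in SS -> B \in NN -> (d %| #|A|)%N -> (d %| #|B|)%N -> False.
  move=> SA NB dA dB; have : (d %| 1)%N.
    suff E : #|B| = (#|A| + 1)%N by rewrite -(dvdn_addr 1 dA) -E.
    by move: (cardS SA) (cardN NB) p_gt7; clear; lia.
  by rewrite dvdn1; move: d1; case: eqP => // ->.
case/setUP: TC => hC; case/setUP: TD => hD.
- exact: split_transitive.
- by case: (aux C D).
- by case: (aux D C).
- exact: nonsplit_transitive.
Qed.

Lemma klein_rotator e v : e \in G -> v \in G -> #[e] = 2 -> #[v] = 2 -> commute e v ->
  e != v -> exists V y, [/\ klein V, e \in V, v \in V, y \in 'N_G(V) &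
    forall a, a \in V -> a != 1 -> a ^ y != a].
Proof.
move=> Ge Gv oe ov cev nev.
have [V [kV Ve Vv]] := klein_gen Ge Gv oe ov cev nev.
have [y [Gy ey vy]] := klein_rotation Ge Gv oe ov cev nev.
have ne : e != 1 by rewrite -order_gt1 oe.
have nv : v != 1 by rewrite -order_gt1 ov.
have EV := klein_enum kV Ve Vv ne nv nev.
have evy : (e * v) ^ y = v.
  by rewrite conjMg ey vy cev -mulgA -expg2 (klein_sq kV Ve) mulg1.
exists V, y; split=> //.
  rewrite inE Gy; apply/normP/eqP; rewrite eqEcard cardJg leqnn andbT.
  apply/subsetP => _ /imsetP[x Vx ->]; move: Vx; rewrite {1}EV !inE -!orbA.
  by case/or4P => /eqP->; rewrite ?conj1g ?ey ?vy ?evy ?groupM.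
move=> a; rewrite EV !inE -!orbA => /or4P[] /eqP-> na.
- by rewrite eqxx in na.
- by rewrite ey -[X in _ != X]mulg1 (inj_eq (mulgI e)).
- by rewrite vy.
- by rewrite evy eq_sym -[X in _ != X]mul1g (inj_eq (mulIg v)).
Qed.

Lemma S_nonempty : exists T, T \in SS.
Proof. by have [T [U [V []]]] := borel_ex; exists T. Qed.

Lemma N_nonempty : exists T, T \in NN.
Proof. by apply/card_gt0P; move: nbN p_gt7; clear; nia. Qed.

Lemma torus_involution_ex : exists T x, [/\ T \in tori, x \in T & #[x] = 2].
Proof.
have [C SC] := S_nonempty; have [D ND] := N_nonempty.
have [T TT eT] : exists2 T, T \in tori & (2 %| #|T|)%N.
  have [eC|oC] := boolP (2 %| #|C|)%N; first by exists C; rewrite // inE SC.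
  exists D; first by rewrite inE ND orbT.
  have E : #|D| = (#|C| + 1)%N by move: (cardS SC) (cardN ND) p_gt7; clear; lia.
  by move: oC; rewrite E !dvdn2 oddD addbT => ->.
by have [//|x Tx ox] := Cauchy _ eT; exists T, x.
Qed.

Lemma inverter_invol T v x : T \in tori -> v \in 'N_G(T) -> v \notin T -> x \in T -> #[x] = 2 ->
  [/\ #[v] = 2, commute x v & x != v].
Proof.
move=> TT Nv nTv Tx ox; have nv : v != 1 by apply: contraNneq nTv => ->; exact: group1.
split; last by apply: contraNneq nTv => <-.
  by apply: nt_prime_order => //; apply: torus_norm TT Nv nTv.
apply/commgP/conjg_fixP; rewrite (torus_invert TT Nv nTv Tx).
by apply: (mulgI x); rewrite mulgV -expg2 -ox expg_order.
Qed.

Lemma cell_torus C x n : C \in cells -> x \in C -> x != 1 -> x ^+ n = 1 ->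
  (0 < n)%N -> (n < 5)%N -> C \in tori.
Proof.
move=> CC Cx nx xn n0 n5; case/setUP: CC => // UU_C.
by move: (unip_exp UU_C Cx nx n0 n5); rewrite xn eqxx.
Qed.

Lemma klein_conj (V : {group gT}) g : g \in G -> klein V -> klein (V :^ g)%G.
Proof.
move=> Gg [sVG cV aV]; split; rewrite ?cardJg ?abelemJ //=.
by rewrite -(conjGid Gg) conjSg.
Qed.

(** One rotation [y] of order 3 exists. Its torus is conjugate to that of [x], since 3 divides both
    orders, and a cyclic torus has only one subgroup of order 3; so [x] generates a conjugate of
    [<[y]>] and rotates a conjugate four-group. *)
Lemma order3_klein x : x \in G -> #[x] = 3 -> exists V, [/\ klein V, x \in 'N_G(V) &
    forall a, a \in V -> a != 1 -> a ^ x != a].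
Proof.
move=> Gx ox; have [T [e [TT Te oe]]] := torus_involution_ex.
have sTG := cell_sub (cellT TT); have Ge := subsetP sTG _ Te.
have [v Nv nTv] := torus_inverter TT.
have Gv : v \in G by case/setIP: Nv.
have [ov cev nev] := inverter_invol TT Nv nTv Te oe.
have [V [y [kV Ve Vv Ny fy]]] := klein_rotator Ge Gv oe ov cev nev.
have Gy : y \in G by case/setIP: Ny.
have ne : e != 1 by rewrite -order_gt1 oe.
have ny : y != 1.
  by apply: contraNneq (fy _ Ve ne) => ->; rewrite conjg1 eqxx.
have oy : #[y] = 3 by apply: nt_prime_order => //; apply: klein_nofix kV Ny fy.
have nx : x != 1 by rewrite -order_gt1 ox.
have [C CC Cx] := cell_cover Gx nx; have [D DD Dy] := cell_cover Gy ny.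
have TC := cell_torus CC Cx nx (etrans (congr1 _ (esym ox)) (expg_order x)) isT isT.
have TD := cell_torus DD Dy ny (etrans (congr1 _ (esym oy)) (expg_order y)) isT isT.
have [|||g Gg EC] := torus_conj_dvd (d := 3) TD TC.
- by [].
- by rewrite -oy order_dvdG.
- by rewrite -ox order_dvdG.
have Cyg : y ^ g \in C by rewrite EC memJ_conjg.
have Exy : <[y ^ g]> = <[x]> by apply: (torus_cycle_eq TC) => //; rewrite orderJ ox.
have NVg : y ^ g \in 'N(V :^ g)%G by rewrite /= normJ memJ_conjg; case/setIP: Ny.
exists (V :^ g)%G; split; first exact: klein_conj.
  rewrite inE Gx /=; apply: subsetP (cycle_id x); rewrite -Exy cycle_subG.
  exact: NVg.
move=> _ /imsetP[a Va ->] nag; apply/eqP => /conjg_fixP/commgP cxa.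
have : y ^ g \in 'C[a ^ g].
  have : <[x]> \subset 'C[a ^ g] by rewrite cycle_subG; apply/cent1P.
  by rewrite -Exy cycle_subG.
move/cent1P/commute_sym/commgP/conjg_fixP; rewrite -conjJg => /conjg_inj E.
by move: (fy a Va); rewrite E eqxx -(conjg_eq1 a g) => /(_ nag).
Qed.

(** Take [v] inverting [T]. From [f ^ v = f^-1] follows [v ^ f = f ^+ 2 * v], so [f] normalizes the
    four-group of [f ^+ 2] and [v]; [y] rotates that four-group. *)
Lemma order4_klein T f : T \in tori -> f \in T -> #[f] = 4 -> exists V y,
  [/\ klein V, f \in 'N_G(V), f ^+ 2 \in V, y \in 'N_G(V) &
    forall a, a \in V -> a != 1 -> a ^ y != a].
Proof.
move=> TT Tf of4; have of2 : #[f ^+ 2] = 2 by rewrite orderXdiv of4.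
have sTG := cell_sub (cellT TT); have Gf := subsetP sTG _ Tf.
have [v Nv nTv] := torus_inverter TT.
have Gv : v \in G by case/setIP: Nv.
have [ov cev nev] := inverter_invol TT Nv nTv (groupX 2 Tf) of2.
have [V [y [kV Ve Vv Ny fy]]] := klein_rotator (groupX 2 Gf) Gv of2 ov cev nev.
exists V, y; split=> //; rewrite inE Gf /=.
have ne : f ^+ 2 != 1 by rewrite -order_gt1 of2.
have nv : v != 1 by rewrite -order_gt1 ov.
have vf : v ^ f = f ^+ 2 * v.
  have vv : v * v = 1 by rewrite -expg2 -ov expg_order.
  have vV : v^-1 = v by apply: (mulgI v); rewrite mulgV vv.
  rewrite cev conjgE -(torus_invert TT Nv nTv Tf) conjgE vV !mulgA -(mulgA _ v v) vv.
  by rewrite mulg1.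
have ff : (f ^+ 2) ^ f = f ^+ 2 by rewrite conjXg conjgE mulKg.
apply/normP/eqP; rewrite eqEcard cardJg leqnn andbT.
apply/subsetP => _ /imsetP[x Vx ->]; move: Vx.
rewrite {1}(klein_enum kV Ve Vv ne nv nev) !inE -!orbA.
case/or4P => /eqP->.
- by rewrite conj1g group1.
- by rewrite ff.
- by rewrite vf; apply: groupM.
- by rewrite conjMg ff vf; apply: groupM => //; apply: groupM.
Qed.

Lemma conj_commg_mem (V : {group gT}) v x : v \in V -> x \in 'N(V) -> [~ v, x] \in V.
Proof. by move=> Vv Nx; rewrite commgEl groupM ?groupV ?memJ_norm. Qed.

Lemma torus_norm_commg T x v : T \in tori -> x \in T -> v \in 'N(T) -> [~ v, x] \in T.
Proof. by move=> TT Tx Nv; rewrite -groupV invg_comm conj_commg_mem. Qed.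

(* [[~ v, x]] is an involution of [V] not fixed by [x]: in ['N(T)] it would lie in [T]
   and commute with [x], in ['N(U)] it would be a p-element. *)
Lemma order3_escape T x V v : T \in tori -> x \in T -> klein V -> x \in 'N_G(V) ->
  (forall a, a \in V -> a != 1 -> a ^ x != a) -> v \in V -> v != 1 ->
  v \notin 'N_G(T) /\ forall U, U \in UU -> T \subset 'N(U) -> v \notin 'N_G(U).
Proof.
move=> TT Tx kV /setIP[Gx NVx] fx Vv nv.
have Vc := conj_commg_mem Vv NVx.
have nc : [~ v, x] != 1.
  by apply: contra (fx v Vv nv) => /commgP/commgP/conjg_fixP/eqP.
split=> [|U UU_U nUT]; apply/negP => /setIP[Gv Nv].
  have Tc := torus_norm_commg TT Tx Nv.
  case/eqP: (fx _ Vc nc); apply/conjg_fixP/commgP.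
  by have /cyclic_abelian/centsP cT := torus_cyclic TT; apply: cT.
have Uc : [~ v, x] \in U.
  apply: (subsetP (borel_der UU_U)); apply: mem_commg; rewrite inE ?Gv ?Gx //.
  exact: subsetP Tx.
have := unip_exp UU_U Uc nc (n := 2) isT isT.
by rewrite (klein_sq kV Vc) eqxx.
Qed.

(** [y] does not commute with [f ^+ 2], so it is not in [T]; normalizing [T] from outside would give
    [y ^+ 2 = 1] besides [y ^+ 3 = 1]. Normalizing [U] would put the nontrivial commutator of
    [f ^+ 2] and [y], an involution of [V], into the p-group [U]. *)
Lemma order4_escape T f V y : T \in tori -> f \in T -> #[f] = 4 -> klein V ->
  f ^+ 2 \in V -> y \in 'N_G(V) -> (forall a, a \in V -> a != 1 -> a ^ y != a) ->
  y \notin 'N_G(T) /\ forall U, U \in UU -> T \subset 'N(U) -> y \notin 'N_G(U).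
Proof.
move=> TT Tf of4 kV Ve Ny fy; have /setIP[Gy NVy] := Ny.
have ne : f ^+ 2 != 1 by rewrite -order_gt1 orderXdiv of4.
have Vc := conj_commg_mem Ve NVy.
have nc : [~ f ^+ 2, y] != 1.
  by apply: contra (fy _ Ve ne) => /commgP/commgP/conjg_fixP/eqP.
split=> [|U UU_U nUT].
  apply/negP => NTy; have [Ty|nTy] := boolP (y \in T).
    case/eqP: (fy _ Ve ne); apply/conjg_fixP/commgP.
    by have /cyclic_abelian/centsP cT := torus_cyclic TT; apply: cT; rewrite // groupX.
  have y2 := torus_norm TT NTy nTy; have y3 := klein_nofix kV Ny fy.
  have y1 : y = 1 by rewrite -y3 expgS y2 mulg1.
  by have := fy _ Ve ne; rewrite y1 conjg1 eqxx.
apply/negP => /setIP[_ Nv].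
have Uc : [~ f ^+ 2, y] \in U.
  apply: (subsetP (borel_der UU_U)); apply: mem_commg; last by rewrite inE Gy.
  by apply: groupX; rewrite inE (subsetP nUT) // (subsetP (cell_sub (cellT TT))).
have := unip_exp UU_U Uc nc (n := 2) isT isT.
by rewrite (klein_sq kV Vc) eqxx.
Qed.

(** On the three involutions of [V], [f] is the transposition fixing [f ^+ 2] and [v] a
    transposition moving it. Their product is a 3-cycle, and [klein_nofix] applies. *)
Lemma klein_order4_prod (V : {group gT}) f v : klein V -> f \in 'N_G(V) -> v \in 'N_G(V) ->
  #[f] = 4 -> #[v] = 2 -> ~ commute (f ^+ 2) v -> (f * v) ^+ 3 = 1.
Proof.
move=> kV Nf Nv of4 ov ncv.
have /setIP[Gf NVf] := Nf; have /setIP[Gv NVv] := Nv.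
have f2n : f ^+ 2 != 1 by rewrite -order_gt1 orderXdiv of4.
have v2 : v ^+ 2 = 1 by rewrite -ov expg_order.
have vV : v^-1 = v by apply: (mulgI v); rewrite mulgV -v2.
have nVf : f \notin V.
  by apply: contra f2n => Vf; rewrite (klein_sq kV Vf).
have Vf2 : f ^+ 2 \in V.
  have := klein_norm_exp kV Nf; case/orP => [/andP[]//|].
  by rewrite -order_dvdn of4.
have fa : (f ^+ 2) ^ f = f ^+ 2 by rewrite conjXg conjgE mulKg.
move: (f ^+ 2) f2n ncv Vf2 fa => a na ncv Va fa.
have nva : a ^ v != a by apply/eqP => /conjg_fixP/commgP.
have fix_f b : b \in V -> b != 1 -> b != a -> b ^ f = a * b.
  move=> Vb nb nba; have nab : a != b by rewrite eq_sym.
  have : b ^ f \in V by rewrite memJ_norm.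
  rewrite {1}(klein_enum kV Va Vb na nb nab) !inE conjg_eq1 (negPf nb) -{1}fa.
  rewrite (inj_eq (conjg_inj f)) (negPf nba) /= => /orP[/eqP fb|/eqP//].
  by case/negP: nVf; apply: klein_self_cent fa fb.
apply: (klein_nofix kV); first by rewrite groupM.
move=> z Vz nz; apply/eqP => fz.
have {fz}fz : z ^ f = z ^ v by apply: (conjg_inj v); rewrite -conjgM fz -conjgM -expg2 v2 conjg1.
have [za|nza] := eqVneq z a.
  by move: fz nva; rewrite za fa => <-; rewrite eqxx.
rewrite (fix_f z Vz nz nza) in fz.
have Vav : a ^ v \in V by rewrite memJ_norm.
have nav1 : a ^ v != 1 by rewrite conjg_eq1.
have [zav|nzav] := eqVneq z (a ^ v).
  move: fz; rewrite zav -conjgM -expg2 v2 conjg1 -[RHS]mulg1 => /mulgI/eqP.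
  by rewrite (negPf nav1).
have navC : a != a ^ v by rewrite eq_sym.
move: Vz fz; rewrite {1}(klein_enum kV Va Vav na nav1 navC) !inE -!orbA.
rewrite (negPf nz) (negPf nza) (negPf nzav) /= => /eqP->.
rewrite [in RHS]conjMg -conjgM -expg2 v2 conjg1.
rewrite (klein_commute kV Vav Va) -[RHS]mul1g => /mulIg/eqP.
by rewrite (negPf na).
Qed.

(** As [v] is its own inverse, [(z * v) ^+ 3 = 1] means [z ^ v = z^-1 * v * z^-1]. Applied to [x]
    and [f], this gives [m = x^-1 * m^-1 * f^-1] for [m = (x * f) ^ v], that is
    [m * x * m = f^-1]. *)
Lemma order3_order4_word (x f v : gT) : commute x f -> v * v = 1 -> (x * v) ^+ 3 = 1 ->
  (f * v) ^+ 3 = 1 -> (((x * f) ^ v) * x) ^+ 2 = f^-1 * x.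
Proof.
move=> cxf vv x3 f3; have vV : v^-1 = v by apply: (mulgI v); rewrite mulgV vv.
have flip z : (z * v) ^+ 3 = 1 -> z ^ v = z^-1 * v * z^-1.
  move=> z3; rewrite conjgE vV; apply: (mulgI z); apply: (mulIg z).
  apply: (mulIg v); move: z3; rewrite !expgS mulg1 !mulgA => ->.
  by rewrite mulgV mul1g mulgKV vv.
set m := (x * f) ^ v.
have mE : m = x^-1 * m^-1 * f^-1.
  have mV : m^-1 = v * (x^-1 * f^-1) * v.
    by rewrite /m -conjVg cxf invMg conjgE vV mulgA.
  by rewrite mV /m conjMg (flip x x3) (flip f f3) !mulgA.
have xm : x * m = m^-1 * f^-1 by rewrite {1}mE !mulgA mulgV mul1g.
have mxm : m * x * m = f^-1 by rewrite -mulgA xm mulKVg.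
by rewrite expgS expg1 mulgA mxm.
Qed.

(* If [Sol G x = Sol G f], some involution [v] outside ['N(T)] satisfies
   [(x v)^3 = (f v)^3 = 1]; then [m := (x f) ^ v] satisfies [(m x)^2 = f^-1 x], so [m]
   is in [T] and [v] normalizes [T] after all. *)
Lemma Sol_order3_order4 T x f : T \in tori -> x \in T -> f \in T -> #[x] = 3 ->
  #[f] = 4 -> Sol G x != Sol G f.
Proof.
move=> TT Tx Tf ox of4; apply/eqP => eqS.
have sTG := cell_sub (cellT TT); have Gx := subsetP sTG _ Tx.
have Gf := subsetP sTG _ Tf.
have cT a b : a \in T -> b \in T -> commute a b.
  by have /cyclic_abelian/centsP c := torus_cyclic TT; move=> Ta Tb; apply: c.
have x3 : x ^+ 3 = 1 by rewrite -ox expg_order.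
have f4 : f ^+ 4 = 1 by rewrite -of4 expg_order.
have [V [kV Nx fx]] := order3_klein Gx ox.
have [v Vv /andP[nv _]] := klein_other 1 kV.
have [nNT nNU] := order3_escape TT Tx kV Nx fx Vv nv.
have sVG : V \subset G by case: kV.
have Gv := subsetP sVG _ Vv.
have ov := klein_order kV Vv nv.
have Nv : v \in 'N_G(V) by rewrite inE Gv (subsetP (normG V)).
have : v \in Sol G x by apply: (Sol_sub (klein_norm_sol kV)); rewrite ?subsetIl.
have f2 : f ^+ 2 != 1 by rewrite -order_gt1 orderXdiv of4.
rewrite eqS => /(Sol_torus TT Tf f2)[Nv'|[U [UU_U nUT Nv']]|[W [kW NWf NWv]]].
- by rewrite Nv' in nNT.
- by have := nNU U UU_U nUT; rewrite Nv'.
have fv3 : (f * v) ^+ 3 = 1.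
  apply: (klein_order4_prod kW) => // cfv; case/negP: nNT; rewrite inE Gv /=.
  apply: (subsetP (cell_cent (cellT TT) (groupX 2 Tf) f2)).
  by rewrite inE Gv; apply/cent1P/commute_sym.
have xv3 : (x * v) ^+ 3 = 1.
  apply: (klein_nofix kV); first by rewrite groupM.
  move=> a Va na; rewrite conjgM; have -> : (a ^ x) ^ v = a ^ x; last exact: fx.
  apply/conjg_fixP/commgP/(klein_commute kV) => //.
  by rewrite memJ_norm //; case/setIP: Nx.
have vv : v * v = 1 by rewrite -expg2 -ov expg_order.
have mx2 := order3_order4_word (cT _ _ Tx Tf) vv xv3 fv3.
set m := (x * f) ^ v in mx2; have Gm : m \in G by rewrite groupJ // groupM.
have n1 : (f^-1 * x) ^+ 2 != 1.
  rewrite expgMn; last by apply: cT; rewrite ?groupV.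
  apply/eqP => E; have : x ^+ 2 = f ^+ 2 by apply: (mulgI (f ^- 2)); rewrite mulVg -expgVn.
  move/(congr1 (expgn^~ 2)); rewrite -!expgM f4 => /eqP.
  by rewrite -order_dvdn ox.
have Tmx : m * x \in T.
  apply: (subsetP (torus_cent TT (_ : f^-1 * x \in T) n1)).
    by rewrite groupM ?groupV.
  by rewrite inE groupM //; apply/cent1P; rewrite -mx2; apply: commuteX.
have Tm : m \in T by rewrite -(groupMr _ Tx).
have nxf : x * f != 1.
  apply/eqP => E; have := expgMn 4 (cT _ _ Tx Tf); rewrite E f4 mulg1 expg1n => /esym/eqP.
  by rewrite -order_dvdn ox.
case/negP: nNT; rewrite inE Gv /=; apply/normP.
have Tvm : m \in (T :^ v)%G by rewrite memJ_conjg groupM.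
have nm : m != 1 by rewrite conjg_eq1.
by rewrite -[RHS](congr_group (cell_TI (cell_conj Gv (cellT TT)) (cellT TT) Tvm Tm nm)).
Qed.

(** * Recovering the cell from the solvabilizer *)

Lemma inverted_nonsplit x : x \in G -> #[x] = 2 -> exists T1 T2 T3,
  [/\ T1 != T2, T1 != T3, T2 != T3 &
   forall T, T \in [:: T1; T2; T3] -> [/\ T \in NN, x \in 'N_G(T) & x \notin T]].
Proof.
move=> Gx ox; have nx : x != 1 by rewrite -order_gt1 ox.
have x2 : x ^+ 2 = 1 by rewrite -ox expg_order.
have [C CC Cx] := cell_cover Gx nx.
have TC := cell_torus CC Cx nx x2 isT isT.
have [T0 N0] := N_nonempty; have TT0 : T0 \in tori by rewrite inE N0 orbT.
have [v0 Nv0 nv0] := torus_inverter TT0; have Gv0 : v0 \in G by case/setIP: Nv0.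
have v02 := torus_norm TT0 Nv0 nv0.
have nv01 : v0 != 1 by apply: contraNneq nv0 => ->; exact: group1.
have ov0 : #[v0] = 2 by apply: nt_prime_order.
have [D DD Dv] := cell_cover Gv0 nv01.
have TD := cell_torus DD Dv nv01 v02 isT isT.
have [|||g Gg EC] := torus_conj_dvd (d := 2) TD TC.
- by [].
- by rewrite -ov0 order_dvdG.
- by rewrite -ox order_dvdG.
have Exv : x = v0 ^ g.
  have Cv : v0 ^ g \in C by rewrite EC memJ_conjg.
  have E : <[x]> = <[v0 ^ g]> by apply: (torus_cycle_eq TC) => //; rewrite orderJ ov0.
  have : x \in <[v0 ^ g]> by rewrite -E cycle_id.
  by rewrite cycle2g ?orderJ // !inE (negPf nx) => /eqP.
(* [v0] inverts [T0] and [x = v0 ^ g], so [x] inverts [S]. The other two tori are conjugates of [S]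
   under powers of [c], which commute with [x]. *)
pose S := (T0 :^ g)%G; have NS : S \in NN by apply: conjN.
have TS : S \in tori by rewrite inE NS orbT.
have xS : x \in 'N_G(S) by rewrite inE Gx Exv /= normJ memJ_conjg; case/setIP: Nv0.
have xnS : x \notin S by rewrite Exv memJ_conjg.
have [c Cc EcC] := torus_big TC; have Gc : c \in G.
  exact: subsetP (cell_sub CC) _ Cc.
have xc k : x ^ (c ^+ k) = x.
  apply/conjg_fixP/commgP.
  by have /cyclic_abelian/centsP cC := torus_cyclic TC; apply: cC; rewrite ?groupX.
(* If [c ^+ k] normalized [S], it would lie in [S], forcing [S = C] to contain [x], or satisfy
   [c ^+ (2k) = 1], impossible since [2k <= 4] and [c] has order at least 5. *)
have notN k : (0 < k)%N -> (k < 3)%N -> (S :^ (c ^+ k))%G != S.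
  move=> k0 k3; apply/eqP => /congr_group /normP NSc.
  have nck n : (0 < n)%N -> (n < 5)%N -> c ^+ n != 1 by apply: torus_exp EcC TC.
  have [Sc|nSc] := boolP (c ^+ k \in S).
    have nk : c ^+ k != 1 by apply: nck => //; apply: leq_trans k3 _.
    by move: xnS; rewrite -(cell_TI CC (cellT TS) (groupX k Cc) Sc nk) Cx.
  have NGc : c ^+ k \in 'N_G(S) by rewrite inE groupX.
  have := torus_norm TS NGc nSc; rewrite -expgM => /eqP.
  rewrite (negPf (nck (k * 2)%N _ _)) //; first by rewrite muln_gt0 k0.
  by case: k k3 {k0 NSc nSc NGc} => [|[|[|]]].
have conj_ne k : (S :^ (c ^+ k))%G \in NN /\ x \in 'N_G(S :^ (c ^+ k)) /\
    x \notin (S :^ (c ^+ k))%G.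
  split; first by rewrite conjN ?groupX.
  rewrite inE Gx normJ -{1}(xc k) -{2}(xc k) !memJ_conjg xnS.
  by case/setIP: xS.
exists S, (S :^ c)%G, (S :^ (c ^+ 2))%G; split.
- by rewrite eq_sym -[c]expg1 notN.
- by rewrite eq_sym notN.
- apply/eqP => /congr_group /= E; case/eqP: (notN 1%N isT isT); apply: val_inj => /=.
  by apply: (@conjsg_inj _ c); rewrite expg1 -conjsgM -expg2.
move=> T; rewrite 3!in_cons in_nil orbF => /or3P[] /eqP->.
- by split.
- by have := conj_ne 1%N; rewrite expg1 => -[? []].
- by have := conj_ne 2 => -[? []].
Qed.

(** For a nontrivial [u] in [U], normalizing [U] means lying in [Sol G u], that is having [u] in
    one's solvabilizer. *)
Lemma Sol_eq_unip U x x' : U \in UU -> x \in G -> x' \in G -> Sol G x = Sol G x' ->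
  x \in 'N(U) -> x' \in 'N(U).
Proof.
move=> UU_U Gx Gx' eqS Nx; have [u Uu nu] : exists2 u, u \in U & u != 1.
  by apply/trivgPn; rewrite -cardG_gt1 (cardU UU_U) prime_gt1.
have Gu := subsetP (cell_sub (cellU UU_U)) _ Uu.
have : x \in Sol G u by rewrite (Sol_unip _ UU_U Uu nu) inE Gx.
move/(Sol_sym Gu); rewrite eqS => /(Sol_sym Gx').
by rewrite (Sol_unip _ UU_U Uu nu) => /setIP[].
Qed.

(** The same symmetry is applied to a generator [t] of [T]: no Borel subgroup contains a nonsplit
    torus, so [Sol G t] is just the normalizer of [T]. *)
Lemma Sol_eq_nonsplit T x x' : T \in NN -> x \in G -> x' \in G -> Sol G x = Sol G x' ->
  x \in 'N(T) -> x' \in 'N(T).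
Proof.
move=> NT Gx Gx' eqS Nx; have TT : T \in tori by rewrite inE NT orbT.
have [t Tt Et] := torus_big TT; have Gt := subsetP (cell_sub (cellT TT)) _ Tt.
have t3 : t ^+ 3 != 1 by apply: torus_exp Et TT _ _.
have t4 : t ^+ 4 != 1 by apply: torus_exp Et TT _ _.
have t1 : t != 1 by rewrite -[t]expg1; apply: torus_exp Et TT _ _.
have : x \in Sol G t by apply/(Sol_big _ TT Tt t3 t4); left; rewrite inE Gx.
move/(Sol_sym Gt); rewrite eqS => /(Sol_sym Gx')/(Sol_big _ TT Tt t3 t4).
case=> [/setIP[]//|[U [UU_U nUT _]]].
by rewrite (nonsplit_borel NT UU_U Tt (subsetP nUT _ Tt)) eqxx in t1.
Qed.

(** A unipotent [x] normalizes exactly one unipotent cell, while an element of a split torus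
    normalizes two and a nontrivial element of a nonsplit torus none. *)
Lemma Sol_eq_unip_cell C D x x' : C \in UU -> D \in cells -> x \in C -> x' \in D ->
  x != 1 -> x' != 1 -> Sol G x = Sol G x' -> C = D.
Proof.
move=> UU_C DD Cx Dx' nx nx' eqS.
have Gx := subsetP (cell_sub (cellU UU_C)) _ Cx.
have Gx' := subsetP (cell_sub DD) _ Dx'.
have Nx' : x' \in 'N(C).
  by apply: (Sol_eq_unip UU_C Gx Gx' eqS); apply: subsetP Cx; apply: normG.
case/setUP: (DD) => [UU_D|/setUP[SD|ND]].
- exact: unip_borel UU_C UU_D Dx' nx' Nx'.
- have [U [V [UU_U UU_V /eqP nUV nUD nVD]]] := split_unip SD.
  have key W : W \in UU -> D \subset 'N(W) -> W = C.
    move=> UU_W nWD; apply: (unip_borel UU_W UU_C Cx nx).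
    by apply: (Sol_eq_unip UU_W Gx' Gx (esym eqS)); apply: subsetP Dx'.
  by case: nUV; rewrite (key U) // (key V).
- by rewrite (nonsplit_borel ND UU_C Dx' Nx') eqxx in nx'.
Qed.

(** [C] normalizes two unipotent cells, so [x'] normalizes both; the two Borel subgroups meet inside
    [C]. *)
Lemma Sol_eq_split_cell C D x x' : C \in SS -> D \in tori -> x \in C -> x' \in D ->
  x != 1 -> x' != 1 -> Sol G x = Sol G x' -> C = D.
Proof.
move=> SC TD Cx Dx' nx nx' eqS.
have Gx := subsetP (cell_sub (cellS SC)) _ Cx.
have Gx' := subsetP (cell_sub (cellT TD)) _ Dx'.
have [U [V [UU_U UU_V nUV nUC nVC]]] := split_unip SC.
have key W : W \in UU -> C \subset 'N(W) -> x' \in 'N(W).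
  move=> UU_W nWC; apply: (Sol_eq_unip UU_W Gx Gx' eqS); exact: subsetP Cx.
have [NU NV] := (key U UU_U nUC, key V UU_V nVC).
case/setUP: TD => [SD|ND]; last first.
  by rewrite (nonsplit_borel ND UU_U Dx' NU) eqxx in nx'.
apply: (cell_TI (cellS SC) (cellS SD) _ Dx' nx').
by apply: (subsetP (borel_meet SC UU_U UU_V nUV nUC nVC)); rewrite !in_setI Gx' NU NV.
Qed.

(* If [C] and [D] differ, [x] and [x'] are commuting involutions, and a nonsplit torus
   normalized by [x] contains [x], [x'] or [x x']; but [x] normalizes three nonsplit
   tori not containing it. *)
Lemma Sol_eq_nonsplit_cell C D x x' : C \in NN -> D \in NN -> x \in C -> x' \in D ->
  x != 1 -> x' != 1 -> Sol G x = Sol G x' -> C = D.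
Proof.
move=> NC ND Cx Dx' nx nx' eqS; apply/eqP/negPn/negP => nCD.
have tN A : A \in NN -> A \in tori by move=> NA; rewrite inE NA orbT.
have [TC TD] := (tN C NC, tN D ND).
have Gx := subsetP (cell_sub (cellT TC)) _ Cx.
have Gx' := subsetP (cell_sub (cellT TD)) _ Dx'.
have Nx' : x' \in 'N_G(C).
  by rewrite inE Gx' (Sol_eq_nonsplit NC Gx Gx' eqS) // (subsetP (normG C)).
have Nx : x \in 'N_G(D).
  by rewrite inE Gx (Sol_eq_nonsplit ND Gx' Gx (esym eqS)) // (subsetP (normG D)).
have nDx : x \notin D.
  by apply: contra nCD => Dx; rewrite (cell_TI (cellT TC) (cellT TD) Cx Dx nx) eqxx.
have nCx' : x' \notin C.
  by apply: contra nCD => Cx'; rewrite (cell_TI (cellT TC) (cellT TD) Cx' Dx' nx') eqxx.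
have ox : #[x] = 2 by apply: nt_prime_order => //; apply: torus_norm TD Nx nDx.
have nxx : x * x' != 1.
  apply: contra nCx' => /eqP E.
  have -> : x' = x^-1 by apply: (mulgI x); rewrite mulgV.
  by rewrite groupV.
have [T1 [T2 [T3 [n12 n13 n23 HT]]]] := inverted_nonsplit Gx ox.
have mem_xx T : T \in [:: T1; T2; T3] -> T != D -> x * x' \in T.
  move=> /HT[NT NTx nTx] nTD; have TT := tN T NT.
  have NTx' : x' \in 'N_G(T).
    by rewrite inE Gx' (Sol_eq_nonsplit NT Gx Gx' eqS) //; case/setIP: NTx.
  have nTx' : x' \notin T.
    by apply: contra nTD => Tx'; rewrite (cell_TI (cellT TT) (cellT TD) Tx' Dx' nx') eqxx.
  have [t Tt Et] := torus_big TT.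
  have t2 : t ^+ 2 != 1 by apply: torus_exp Et TT _ _.
  apply: (subsetP (torus_cent TT Tt t2)); rewrite inE groupM //.
  apply/cent1P/commute_sym; apply/commgP/conjg_fixP.
  by rewrite conjgM (torus_invert TT NTx nTx Tt) conjVg (torus_invert TT NTx' nTx' Tt) invgK.
have eqT A B : A \in [:: T1; T2; T3] -> B \in [:: T1; T2; T3] ->
    A != D -> B != D -> A = B.
  move=> mA mB nA nB; have [/tN TA _ _] := HT A mA; have [/tN TB _ _] := HT B mB.
  exact: cell_TI (cellT TA) (cellT TB) (mem_xx A mA nA) (mem_xx B mB nB) nxx.
have [m1 m2 m3] : [/\ T1 \in [:: T1; T2; T3], T2 \in [:: T1; T2; T3]
    & T3 \in [:: T1; T2; T3]] by rewrite 9!in_cons !eqxx !orbT.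
have [E1|n1] := eqVneq T1 D.
  by case/eqP: n23; apply: eqT => //; rewrite -E1 eq_sym.
have [E2|n2] := eqVneq T2 D.
  by case/eqP: n13; apply: eqT => //; rewrite -E2 eq_sym.
by case/eqP: n12; apply: eqT.
Qed.

Lemma Sol_eq_cell C D x x' : C \in cells -> D \in cells -> x \in C -> x' \in D ->
  x != 1 -> x' != 1 -> Sol G x = Sol G x' -> C = D.
Proof.
move=> CC DD Cx Dx' nx nx' eqS.
have [UU_C|nUC] := boolP (C \in UU); first exact: Sol_eq_unip_cell eqS.
have [UU_D|nUD] := boolP (D \in UU).
  by apply/esym; apply: Sol_eq_unip_cell (esym eqS).
have TC : C \in tori by move: CC; rewrite inE (negPf nUC).
have TD : D \in tori by move: DD; rewrite inE (negPf nUD).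
have [SC|nSC] := boolP (C \in SS); first exact: Sol_eq_split_cell eqS.
have [SD|nSD] := boolP (D \in SS).
  by apply/esym; apply: Sol_eq_split_cell (esym eqS).
apply: Sol_eq_nonsplit_cell eqS => //.
  by move: TC; rewrite inE (negPf nSC).
by move: TD; rewrite inE (negPf nSD).
Qed.

(** The identity lies in every Borel subgroup, so [x] and its conjugates would too, hence all in one
    split torus [C]. For [u] in a unipotent cell [U], the commutator of [x] and [u] is then in both
    [C] and [U], thus trivial, and [x] itself falls into both. *)
Lemma Sol_nontrivial x : x \in G -> x != 1 -> Sol G x != Sol G 1.
Proof.
move=> Gx nx; apply/eqP => eqS.
have allU U : U \in UU -> x \in 'N(U).
  by move=> UU_U; apply: (Sol_eq_unip UU_U (group1 G) Gx (esym eqS)); apply: group1.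
have [C SC] := S_nonempty.
have [U [V [UU_U UU_V nUV nUC nVC]]] := split_unip SC.
have [u Uu nu] : exists2 u, u \in U & u != 1.
  by apply/trivgPn; rewrite -cardG_gt1 (cardU UU_U) prime_gt1.
have Gu := subsetP (cell_sub (cellU UU_U)) _ Uu.
have inC g : g \in G -> x ^ g \in C.
  move=> Gg; apply: (subsetP (borel_meet SC UU_U UU_V nUV nUC nVC)).
  have aux W : W \in UU -> x ^ g \in 'N_G(W).
    move=> UU_W; rewrite inE groupJ //= -mem_conjgV -normJ.
    by apply: (allU (W :^ g^-1)%G); rewrite conjU ?groupV.
  by rewrite inE !aux.
have Cx : x \in C by rewrite -[x]conjg1 inC.
have disj y : y \in U -> y \in C -> y = 1.
  move=> Uy Cy; apply/eqP/negPn/negP => ny.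
  have E := cell_TI (cellU UU_U) (cellS SC) Uy Cy ny.
  have [d _] := cells_disjoint.
  by have := disjointFr d UU_U; rewrite E inE SC.
have Cc : [~ x, u] \in C by rewrite commgEl groupM ?groupV ?inC.
have Uc : [~ x, u] \in U.
  by rewrite -groupV invg_comm conj_commg_mem // allU.
have c1 := disj _ Uc Cc.
have Ux : x \in U.
  apply: (subsetP (unip_cent UU_U Uu nu)); rewrite inE Gx; apply/cent1P/commgP.
  by rewrite c1.
by rewrite (disj x Ux Cx) eqxx in nx.
Qed.

(** * Solvabilizers within one torus *)

Lemma Sol_eq_invol T x x' : T \in tori -> x \in T -> x' \in T -> x' != 1 ->
  Sol G x = Sol G x' -> #[x] = 2 -> #[x'] = 2.
Proof.
move=> TT Tx Tx' nx' eqS ox; have sTG := cell_sub (cellT TT).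
have [Gx Gx'] := (subsetP sTG _ Tx, subsetP sTG _ Tx').
have [A [B [C [_ _ _ HA]]]] := inverted_nonsplit Gx ox.
(* [x] inverts the nonsplit torus [A], so [x'] normalizes it. Were [x'] in [A], then [A = T] would
   contain [x]; hence [x'] normalizes from outside and squares to 1. *)
have [NA NAx nAx] := HA A (mem_head _ _); have TA : A \in tori by rewrite inE NA orbT.
have NAx' : x' \in 'N_G(A).
  by rewrite inE Gx' (Sol_eq_nonsplit NA Gx Gx' eqS) //; case/setIP: NAx.
apply: nt_prime_order => //; apply: (torus_norm TA NAx').
by apply: contra nAx => Ax'; rewrite (cell_TI (cellT TA) (cellT TT) Ax' Tx' nx').
Qed.

Lemma Sol_order3_big T x x' : T \in tori -> x \in T -> x' \in T -> #[x] = 3 ->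
  x' ^+ 3 != 1 -> x' ^+ 4 != 1 -> Sol G x != Sol G x'.
Proof.
move=> TT Tx Tx' ox x3 x4; apply/eqP => eqS.
have sTG := cell_sub (cellT TT); have Gx := subsetP sTG _ Tx.
have [V [kV Nx fx]] := order3_klein Gx ox.
have [v Vv /andP[nv _]] := klein_other 1 kV.
have [nNT nNU] := order3_escape TT Tx kV Nx fx Vv nv.
have Nv : v \in 'N_G(V).
  by rewrite inE (subsetP (normG V)) // andbT; case: kV => /subsetP->.
have : v \in Sol G x by apply: (Sol_sub (klein_norm_sol kV)); rewrite ?subsetIl.
rewrite eqS => /(Sol_big _ TT Tx' x3 x4)[|[U [UU_U nUT]]]; apply/negP => //.
exact: nNU.
Qed.

Lemma Sol_order4_big T x x' : T \in tori -> x \in T -> x' \in T -> #[x] = 4 ->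
  x' ^+ 3 != 1 -> x' ^+ 4 != 1 -> Sol G x != Sol G x'.
Proof.
move=> TT Tx Tx' ox x3 x4; apply/eqP => eqS.
have [V [y [kV Nx Vx2 Ny fy]]] := order4_klein TT Tx ox.
have [nNT nNU] := order4_escape TT Tx ox kV Vx2 Ny fy.
have : y \in Sol G x by apply: (Sol_sub (klein_norm_sol kV)); rewrite ?subsetIl.
rewrite eqS => /(Sol_big _ TT Tx' x3 x4)[|[U [UU_U nUT]]]; apply/negP => //.
exact: nNU.
Qed.

(** The value 0 stands for all orders above 4. The test by cubes and fourth powers matches the
    hypotheses of [Sol_big], and the finite type lets the classes be enumerated. *)
Definition order_class (x : gT) : 'I_5 :=
  inord (if (x ^+ 3 == 1) || (x ^+ 4 == 1) then #[x] else 0).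

Lemma order_class_val x : order_class x = (if (#[x] < 5)%N then #[x] else 0%N) :> nat.
Proof.
have ox := order_gt0 x; rewrite /order_class -!order_dvdn.
have -> : (#[x] %| 3) || (#[x] %| 4) = (#[x] < 5)%N.
  apply/orP/idP => [[] /dvdn_leq h|]; first exact: leq_ltn_trans (h isT) _.
    exact: leq_ltn_trans (h isT) _.
  by move: ox; case: #[x] => [|[|[|[|[|]]]]] //= _ _; [left|right|left|right].
by case: ltnP => [o5|_]; rewrite inordK.
Qed.

(** Equal orders in a cyclic torus give equal cyclic subgroups, and above order 4 [Sol_big]
    describes a set depending on [T] only. Conversely, involutions are recognized by [Sol_eq_invol],
    and orders 3 and 4 are told from larger ones by the escaping elements and from each other by the
    word identity. *)
Lemma Sol_eq_class T x x' : T \in tori -> x \in T -> x' \in T -> x != 1 -> x' != 1 ->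
  Sol G x = Sol G x' <-> order_class x = order_class x'.
Proof.
move=> TT Tx Tx' nx nx'.
have sTG := cell_sub (cellT TT).
have big (y : gT) : (5 <= #[y])%N -> y ^+ 3 != 1 /\ y ^+ 4 != 1.
  move=> y5; rewrite -!order_dvdn.
  by split; apply/negP => /dvdn_leq h; have := leq_trans y5 (h isT).
have ox1 : (1 < #[x])%N by rewrite order_gt1.
have ox1' : (1 < #[x'])%N by rewrite order_gt1.
split=> [eqS|/(congr1 (@nat_of_ord 5))]; last first.
  rewrite !order_class_val; case: ltnP => o5; case: ltnP => o5' E.
  - have Exx' := torus_cycle_eq TT Tx Tx' E.
    have eqg y : <<[set x; y]>> = <<[set x'; y]>>.
      have eqJ : <[x]> <*> [set y] = <[x']> <*> [set y] by rewrite Exx'.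
      exact: etrans (esym (joing_idl _ _)) (etrans eqJ (joing_idl _ _)).
    by apply/setP => y; rewrite !inE eqg.
  - by rewrite E in ox1.
  - by rewrite -E in ox1'.
  - have [[x3 x4] [x3' x4']] := (big x o5, big x' o5').
    apply/setP => y; apply/idP/idP.
      by move/(Sol_big _ TT Tx x3 x4)/(Sol_big _ TT Tx' x3' x4').
    by move/(Sol_big _ TT Tx' x3' x4')/(Sol_big _ TT Tx x3 x4).
apply: val_inj; rewrite /= !order_class_val.
wlog lexx : x x' Tx Tx' nx nx' ox1 ox1' eqS / (#[x] <= #[x'])%N.
  by move=> IH; case: (leqP #[x] #[x']) => [|/ltnW] h; [|apply/esym]; apply: IH.
case: (ltnP #[x] 5) => [o5|o5]; last by rewrite ltnNge (leq_trans o5 lexx).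
have ord : [\/ #[x] = 2, #[x] = 3 | #[x] = 4].
  move: ox1 o5; case: #[x] => [|[|[|[|[|n]]]]] //= _ _.
  - by constructor 1.
  - by constructor 2.
  - by constructor 3.
case: ord => ox.
- by rewrite ox (Sol_eq_invol TT Tx Tx' nx' eqS ox).
- rewrite ox in lexx *; case: (ltnP #[x'] 5) => [o5'|/big[x3 x4]].
    have [//|ox'] : 3 = #[x'] \/ #[x'] = 4.
      by move: lexx o5'; case: #[x'] => [|[|[|[|[|n]]]]] //= _ _; [left|right].
    by move: (Sol_order3_order4 TT Tx Tx' ox ox'); rewrite eqS eqxx.
  by move: (Sol_order3_big TT Tx Tx' ox x3 x4); rewrite eqS eqxx.
- rewrite ox in lexx *; case: (ltnP #[x'] 5) => [o5'|/big[x3 x4]].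
    by apply/eqP; rewrite eqn_leq lexx -ltnS.
  by move: (Sol_order4_big TT Tx Tx' ox x3 x4); rewrite eqS eqxx.
Qed.

(** * Counting solvabilizers cell by cell *)

Definition torus_count n := (1 + (2 %| n) + (3 %| n) + (4 %| n))%N.

Lemma card_Sol_torus T : T \in tori ->
  #|[set Sol G x | x in T^#]| = torus_count #|T|.
Proof.
move=> TT; have -> : #|[set Sol G x | x in T^#]| = #|[set order_class x | x in T^#]|.
  apply: eq_card_imset => x x'; rewrite !inE => /andP[nx Tx] /andP[nx' Tx'].
  exact: (Sol_eq_class TT Tx Tx' nx nx').
have [t Tt Et] := torus_big TT; have T5 := card_torus_gt TT.
have oT : #[t] = #|T| by rewrite Et.
have -> : [set order_class x | x in T^#] =
    [set i : 'I_5 | (i == 0 :> nat) || (1 < i)%N && (i %| #|T|)%N].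
  apply/setP => i; rewrite inE; apply/imsetP/idP => [[x /setD1P[nx Tx] ->]|].
    rewrite order_class_val; case: ltnP => //= o5.
    by rewrite order_gt1 nx order_dvdG ?orbT.
  (* Class 0 is attained by the generator, of order at least 5, and the class of a divisor [i > 1]
     by the power of exponent [|T| / i]. *)
  case/orP => [/eqP i0|/andP[i1 iT]].
    exists t; first by rewrite !inE -order_gt1 oT Tt (leq_trans _ T5).
    by apply: val_inj; rewrite /= order_class_val i0 oT ltnNge T5.
  have oti : #[t ^+ (#|T| %/ i)] = i.
    by rewrite orderXdiv oT ?dvdn_div // divnA // mulKn ?cardG_gt0.
  exists (t ^+ (#|T| %/ i)); first by rewrite !inE -order_gt1 oti i1 groupX.
  by apply: val_inj; rewrite /= order_class_val oti ltn_ord.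
rewrite -sum1_card big_mkcond /= !big_ord_recl big_ord0 !inE /= /torus_count.
by rewrite !addnA !addn0; do 3!case: (_ %| _).
Qed.

Lemma card_Sol_unip U : U \in UU -> #|[set Sol G x | x in U^#]| = 1%N.
Proof.
move=> UU_U; have [u Uu nu] : exists2 u, u \in U & u != 1.
  by apply/trivgPn; rewrite -cardG_gt1 (cardU UU_U) prime_gt1.
suff -> : [set Sol G x | x in U^#] = [set Sol G u] by rewrite cards1.
apply/setP => S; rewrite inE; apply/imsetP/eqP => [[x /setD1P[nx Ux] ->]|->].
  by apply/setP => y; rewrite (Sol_unip y UU_U Ux nx) (Sol_unip y UU_U Uu nu).
by exists u; rewrite // !inE nu.
Qed.

(** The leading 1 is [Sol G 1], which no other element shares; all other solvabilizers are sorted by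
    cell, without repetition by [Sol_eq_cell]. *)
Theorem card_Solv_partitioned : #|Solv G| =
  (1 + p.+1 + #|SS| * torus_count p.-1./2 + #|NN| * torus_count p.+1./2)%N.
Proof.
have -> : Solv G = Sol G 1 |: [set Sol G x | x in G^#].
  by rewrite /Solv -imsetU1 setD1K.
rewrite cardsU1; have -> : Sol G 1 \notin [set Sol G x | x in G^#].
  apply/imsetP => -[x /setD1P[nx Gx] /esym/eqP].
  by rewrite (negPf (Sol_nontrivial Gx nx)).
have -> : #|[set Sol G x | x in G^#]| =
    (\sum_(C in cells) #|[set Sol G x | x in C^#]|)%N.
  apply: card_disjoint_cover => [S /imsetP[x /setD1P[nx Gx] ->]|C CC|C D S CC DD].
  - have [C CC Cx] := cell_cover Gx nx.
    by exists C => //; apply: imset_f; rewrite !inE nx.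
  - exact/imsetS/setSD/cell_sub.
  move=> /imsetP[x /setD1P[nx Cx] ->] /imsetP[y /setD1P[ny Dy] E].
  exact: Sol_eq_cell Cx Dy nx ny E.
have [dUT dSN] := cells_disjoint; rewrite !big_disjoint_setU // -!addnA.
congr (_ + _)%N; congr (_ + (_ + _))%N.
- by rewrite (eq_bigr (fun=> 1%N)) => [|U /card_Sol_unip //]; rewrite sum1_card nbU.
- rewrite -sum_nat_const; apply: eq_bigr => T ST.
  by rewrite card_Sol_torus ?inE ?ST // -(cardS ST) muln2 doubleK.
- rewrite -sum_nat_const; apply: eq_bigr => T NT.
  by rewrite card_Sol_torus ?inE ?NT ?orbT // -(cardN NT) muln2 doubleK.
Qed.

End PartitionedGroup.

(** * Quadratic equations over a finite field *)

Section FiniteFieldCounts.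

Variable F : finFieldType.
Hypothesis two_nz : (2 != 0 :> F)%R.
Local Open Scope ring_scope.
Notation q := #|F|.

Definition issquare (d : F) := [exists s, s ^+ 2 == d].

Lemma issquareP d : reflect (exists s, s ^+ 2 = d) (issquare d).
Proof. by apply: (iffP existsP) => -[s /eqP]; exists s. Qed.

Lemma neq_opp (x : F) : x != 0 -> x != - x.
Proof. by move=> nx; rewrite -subr_eq0 opprK -mulr2n -mulr_natl mulf_neq0. Qed.

Lemma card_sqrt (d : F) :
  #|[set x : F | x ^+ 2 == d]| = (if d == 0%R then 1 else if issquare d then 2 else 0)%N.
Proof.
have [->|nd] := eqVneq d 0.
  by rewrite (_ : finset _ = [set 0]) ?cards1 //; apply/setP => x; rewrite !inE sqrf_eq0.
case: issquareP => [[s sd]|ns]; last first.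
  by apply: eq_card0 => x; rewrite inE; apply/eqP => xd; case: ns; exists x.
rewrite (_ : finset _ = [set s; - s]); last by apply/setP => x; rewrite !inE -sd eqf_sqr.
by rewrite cards2 neq_opp // -sqrf_eq0 sd.
Qed.

Lemma card_hyperbola (k : F) :
  #|[set yz : F * F | yz.1 * yz.2 == k]| = (if k == 0%R then q + q.-1 else q.-1)%N.
Proof.
have q0 : (0 < q)%N by apply/card_gt0P; exists 0.
have cF : #|[set~ (0 : F)]| = q.-1 by rewrite cardsC1.
have [->|nk] := eqVneq k 0.
  rewrite (_ : finset _ = setX [set 0] setT :|: setX [set~ 0] [set 0]); last first.
    by apply/setP => -[y z]; rewrite !inE /= mulf_eq0 andbT; case: (y == 0).
  rewrite cardsU !cardsX cards1 cF cardsT mul1n muln1 (_ : _ :&: _ = set0) ?cards0 ?subn0 //.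
  by apply/setP => -[y z]; rewrite !inE /= andbT; case: (y == 0).
rewrite -cF -(card_imset _ (_ : injective (fun y : F => (y, k / y)))); last by move=> x y [].
apply: eq_card => -[y z]; rewrite inE /=; apply/eqP/imsetP => [yz|[x]].
  have ny : y != 0 by apply: contraNneq nk => y0; rewrite -yz y0 mul0r.
  by exists y; rewrite ?inE // -yz mulrC mulKf.
by rewrite !inE => nx [-> ->]; rewrite mulrC divfK.
Qed.

(** The form is [disc] of the trace-zero matrix with rows [(x, y)] and [(z, -x)]. Fixing [x] leaves
    the hyperbola [y z = d - x^2], which has [q] extra points when [x^2 = d]. *)
Lemma card_quadric (d : F) :
  #|[set t : F * (F * F) | t.1 ^+ 2 + t.2.1 * t.2.2 == d]| =
  (q * q.-1 + q * #|[set x : F | x ^+ 2 == d]|)%N.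
Proof.
rewrite (@card_disjoint_cover _ _ _ [set: F] (fun x => setX [set x]
   [set yz : F * F | (yz.1 * yz.2 == d - x ^+ 2)%R])); last first.
- by move=> x x' [u v] _ _; rewrite !inE /= => /andP[/eqP <- _] /andP[/eqP <- _].
- move=> x _; apply/subsetP => -[u [y z]]; rewrite !inE /= => /andP[/eqP-> /eqP->].
  by rewrite addrC subrK.
- move=> [u [y z]]; rewrite inE /= => /eqP <-; exists u; rewrite ?inE //= eqxx /=.
  by rewrite addrC addKr.
rewrite (eq_bigr (fun x => q.-1 + (x ^+ 2 == d) * q)%N) => [|x _]; last first.
  by rewrite cardsX cards1 mul1n card_hyperbola subr_eq0 eq_sym; case: eqP => _ /=; lia.
rewrite big_split /= sum_nat_const cardsT -big_distrl /=.
congr (_ + _)%N; rewrite mulnC; congr (_ * _)%N.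
rewrite -sum1_card big_mkcond [RHS]big_mkcond /=.
by apply: eq_bigr => x _; rewrite !inE; case: eqP.
Qed.

Lemma card_conic0 : #|[set ab : F * F | ab.1 ^+ 2 == 1]| = (2 * q)%N.
Proof.
have c2 : #|[set x : F | x ^+ 2 == 1]| = 2%N.
  rewrite card_sqrt oner_eq0; case: issquareP => // -[]; exists 1; exact: expr1n.
by rewrite -[in RHS]c2 -cardsT -cardsX; apply: eq_card => -[a b]; rewrite !inE /= andbT.
Qed.

(** The form factors as [(a + s b)(a - s b)], so a point is determined by the nonzero value
    [u = a + s b], with [a - s b] its inverse. *)
Lemma card_conic_split (s : F) : s != 0 ->
  #|[set ab : F * F | ab.1 ^+ 2 - s ^+ 2 * ab.2 ^+ 2 == 1]| = q.-1.
Proof.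
move=> ns; rewrite -(cardsC1 (0 : F)).
pose f (u : F) := ((u + u^-1) / 2, (u - u^-1) / (2 * s)).
have fK u : u = (f u).1 + s * (f u).2.
  by rewrite /f /=; move: (u^-1) => w; field; rewrite ?two_nz ?ns.
have finj : injective f by move=> u v E; rewrite (fK u) (fK v) E.
rewrite -(card_imset _ finj); apply: eq_card => -[a b]; rewrite inE /=.
apply/eqP/imsetP => [E|[u]]; last first.
  rewrite !inE => nu [-> ->]; field; by rewrite two_nz ns nu.
have nu : a + s * b != 0.
  apply/eqP => u0; have : 1 = (a + s * b) * (a - s * b) :> F by rewrite -E; ring.
  by move/eqP; rewrite u0 mul0r oner_eq0.
have Eu : (a + s * b)^-1 = a - s * b.
  by apply: (mulfI nu); rewrite mulfV // -E; ring.
exists (a + s * b); rewrite ?inE // /f Eu; congr pair; field; rewrite ?two_nz ?ns //.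
Qed.

(** Rational parametrization by lines through [(-1, 0)], with slope [t = b / (a + 1)]. The
    denominator [1 - d t^2] never vanishes for a nonsquare [d], so there are [q] points besides the
    base point. *)
Lemma card_conic_nonsplit (d : F) : ~~ issquare d ->
  #|[set ab : F * F | ab.1 ^+ 2 - d * ab.2 ^+ 2 == 1]| = q.+1.
Proof.
move=> nsq; have nd t : 1 - d * t ^+ 2 != 0.
  apply: contra nsq => /eqP E; apply/issquareP; exists t^-1.
  have nt : t != 0.
    by apply: contra_eqN E => /eqP->; rewrite expr0n /= mulr0 subr0 oner_eq0.
  apply: (mulIf (expf_neq0 2 nt)); rewrite -exprMn mulVf // expr1n.
  by apply/eqP; rewrite -subr_eq0 E.
pose f (t : F) := ((1 + d * t ^+ 2) / (1 - d * t ^+ 2), 2 * t / (1 - d * t ^+ 2)).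
have fK t : t = (f t).2 / ((f t).1 + 1).
  have -> : (f t).1 + 1 = 2 / (1 - d * t ^+ 2) by rewrite /f /=; field.
  by rewrite /f /=; field; rewrite two_nz nd.
have finj : injective f by move=> u v E; rewrite (fK u) (fK v) E.
have f1 t : (f t).1 != -1.
  rewrite -subr_eq0 opprK.
  have -> : (f t).1 + 1 = 2 / (1 - d * t ^+ 2) by rewrite /f /=; field.
  by rewrite mulf_neq0 ?invr_neq0.
rewrite (_ : finset _ = (-1, 0) |: f @: setT); last first.
  apply/setP => -[a b]; rewrite !inE xpair_eqE /=; apply/eqP/orP => [E|].
    have db : d * b ^+ 2 = a ^+ 2 - 1 by rewrite -E; ring.
    have [a1|na1] := eqVneq a (-1).
      left; move: db; rewrite a1 sqrrN expr1n subrr /= => /eqP.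
      rewrite mulf_eq0 sqrf_eq0 => /orP[/eqP d0|//]; case/negP: nsq.
      by apply/issquareP; exists 0; rewrite expr0n d0.
    right; have na : a + 1 != 0 by rewrite -subr_eq0 opprK in na1.
    have dt : d * (b / (a + 1)) ^+ 2 = (a - 1) / (a + 1).
      by rewrite expr_div_n mulrA db; field.
    apply/imsetP; exists (b / (a + 1)); rewrite // /f dt; congr pair; field.
      by rewrite na (_ : _ - _ = 2) //; ring.
    by rewrite na (_ : _ - _ = 2) //; ring.
  case=> [/andP[/eqP-> /eqP->]|/imsetP[t _ [-> ->]]].
    by rewrite sqrrN expr1n expr0n /= mulr0 subr0.
  by field; apply: nd.
rewrite cardsU1 card_imset // cardsT (_ : _ \notin _) ?add1n //.
by apply/imsetP => -[t _ [E _]]; have := f1 t; rewrite /f /= -E eqxx.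
Qed.

Lemma card_nonzero_squares : (#|[set d : F | issquare d & (d != 0)%R]| * 2)%N = q.-1.
Proof.
rewrite -(cardsC1 (0 : F)).
have -> : [set d : F | issquare d & d != 0] = (fun x => x ^+ 2) @: [set~ 0].
  apply/setP => d; rewrite inE; apply/andP/imsetP => [[/issquareP[s <-]]|[s]].
    by rewrite sqrf_eq0 => ns; exists s; rewrite ?inE.
  by rewrite !inE => ns ->; rewrite sqrf_eq0 ns; split=> //; apply/issquareP; exists s.
apply/esym/card_fibers => x; rewrite !inE => nx.
have := card_sqrt (x ^+ 2).
rewrite sqrf_eq0 (negPf nx); case: issquareP => [_|[]]; last by exists x.
move=> c2; rewrite -[RHS]c2; apply: eq_card => y; rewrite !inE andbC; case: eqP => //= E.
by rewrite -sqrf_eq0 E sqrf_eq0 nx.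
Qed.

Lemma nonsquare_ex : exists d, ~~ issquare d.
Proof.
apply/existsP; rewrite -negb_forall; apply/negP => /forallP sq.
have := card_nonzero_squares; rewrite -(cardsC1 (0 : F)) (_ : finset _ = [set~ 0]).
  have : (0 < #|[set~ (0%R : F)]|)%N by apply/card_gt0P; exists 1; rewrite !inE oner_eq0.
  by move: #|_| => n n0; clear - n0; lia.
by apply/setP => d; rewrite !inE sq.
Qed.

(** The nonzero squares and their multiples by [d] are disjoint sets of [(q - 1)/2] elements each,
    hence cover all nonzero elements. *)
Lemma nonsquare_ratio (d e : F) : ~~ issquare d -> ~~ issquare e ->
  exists2 c, c != 0 & e = c ^+ 2 * d.
Proof.
move=> nd ne.
have nz x : ~~ issquare x -> x != 0.
  by apply: contra => /eqP->; apply/issquareP; exists 0; rewrite expr0n.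
pose Q := [set x : F | issquare x & x != 0].
have cQ := card_nonzero_squares; rewrite -/Q in cQ.
have injd : injective ( *%R^~ d) := mulIf (nz d nd).
have dis : Q :&: ( *%R^~ d) @: Q = set0.
  apply/setP => x; rewrite !inE; apply/negP => /andP[/andP[/issquareP[s <-] ns]].
  case/imsetP => y; rewrite inE => /andP[/issquareP[t <-] nt] E.
  case/negP: nd; apply/issquareP; exists (s / t).
  by rewrite expr_div_n E mulrAC mulfV ?mul1r.
have : Q :|: ( *%R^~ d) @: Q = [set~ 0].
  apply/eqP; rewrite eqEcard cardsU dis cards0 subn0 card_imset // cardsC1 -cQ.
  rewrite muln2 addnn leqnn andbT; apply/subsetP => x.
  rewrite !inE => /orP[/andP[]//|/imsetP[y]].
  by rewrite inE => /andP[_ ny] ->; rewrite mulf_neq0 // nz.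
move/setP/(_ e); rewrite !inE (negPf ne) nz //= => /imsetP[y].
rewrite inE => /andP[/issquareP[c <-] nc] ->; exists c => //.
by rewrite -sqrf_eq0.
Qed.

End FiniteFieldCounts.

(** * Two-by-two matrices *)

Section TwoByTwo.

Variable R : comNzRingType.
Local Open Scope ring_scope.
Implicit Types A B M : 'M[R]_2.

Lemma mx2_eq A B : A 0 0 = B 0 0 -> A 0 1 = B 0 1 -> A 1 0 = B 1 0 -> A 1 1 = B 1 1 -> A = B.
Proof.
move=> h00 h01 h10 h11; apply/matrixP => i j.
have ord2 (k : 'I_2) : k = 0 \/ k = 1.
  by case: k => [[|[|//]] h]; [left|right]; apply: val_inj.
by case: (ord2 i) => ->; case: (ord2 j) => ->.
Qed.

Lemma sum2E (f : 'I_2 -> R) : \sum_i f i = f 0 + f 1.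
Proof.
by rewrite !big_ord_recl big_ord0 addr0; congr (_ + f _); apply: val_inj.
Qed.

Lemma mulmx2E A B i j : (A *m B) i j = A i 0 * B 0 j + A i 1 * B 1 j.
Proof. by rewrite mxE sum2E. Qed.

Lemma mxtrace2E A : \tr A = A 0 0 + A 1 1.
Proof. exact: sum2E. Qed.

Lemma det2E A : \det A = A 0 0 * A 1 1 - A 0 1 * A 1 0.
Proof.
rewrite (expand_det_row _ 0) sum2E /cofactor !det_mx11 !mxE /= !addn0 !expr0 !add0n.
rewrite expr1 mul1r mulN1r mulrN.
by congr (A _ _ * A _ _ - A _ _ * A _ _); apply: val_inj.
Qed.

Lemma conj_commute_eq (A B H M : 'M[R]_2) : A *m B = 1%:M -> B *m A = 1%:M ->
  (A *m (H *m B) *m M == M *m (A *m (H *m B))) =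
  (H *m (B *m M *m A) == B *m M *m A *m H).
Proof.
move=> AB BA; have ABK C : A *m (B *m C) = C by rewrite mulmxA AB mul1mx.
have BAK C : B *m (A *m C) = C by rewrite mulmxA BA mul1mx.
apply/eqP/eqP => [E|E].
  have := congr1 (fun C => B *m C *m A) E; rewrite -!mulmxA !BAK BA mulmx1.
  by move=> ->.
have := congr1 (fun C => A *m C *m B) E; rewrite -!mulmxA !ABK AB mulmx1.
by move=> ->.
Qed.

Lemma mx2_cayley A : A *m A = \tr A *: A - (\det A)%:M.
Proof.
apply: mx2_eq; rewrite mulmx2E !mxE mxtrace2E det2E /= ?mulr1n ?mulr0n; ring.
Qed.

Definition mx2 (a b c d : R) : 'M[R]_2 :=
  \matrix_(i, j) if i == 0 then if j == 0 then a else b else if j == 0 then c else d.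

Lemma mx2K a b c d : [/\ mx2 a b c d 0 0 = a, mx2 a b c d 0 1 = b,
  mx2 a b c d 1 0 = c & mx2 a b c d 1 1 = d].
Proof. by split; rewrite mxE. Qed.

End TwoByTwo.

(** * Trace-zero matrices and the matrices commuting with them *)

Section TraceZero.

Variable F : fieldType.
Hypothesis two_nz : (2 != 0 :> F)%R.
Local Open Scope ring_scope.
Implicit Types A B M : 'M[F]_2.

(* For trace-zero [M], a quarter of the discriminant of the characteristic polynomial. *)
Definition disc M := - \det M.

Lemma trace0E M : \tr M = 0 -> M 1 1 = - M 0 0.
Proof. by rewrite mxtrace2E => /eqP; rewrite addr_eq0 => /eqP ->; rewrite opprK. Qed.

Lemma trace0_sq M : \tr M = 0 -> M *m M = (disc M)%:M.
Proof. by move=> t0; rewrite mx2_cayley t0 scale0r sub0r /disc raddfN. Qed.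

Lemma mx2_neq0 A : A != 0 -> [\/ A 0 0 != 0, A 0 1 != 0, A 1 0 != 0 | A 1 1 != 0].
Proof.
move=> nA; have [h00|] := eqVneq (A 0 0) 0; last by constructor 1.
have [h01|] := eqVneq (A 0 1) 0; last by constructor 2.
have [h10|] := eqVneq (A 1 0) 0; last by constructor 3.
have [h11|] := eqVneq (A 1 1) 0; last by constructor 4.
by case/eqP: nA; apply: mx2_eq; rewrite ?mxE.
Qed.

(** Commuting says that [(a - d, b, c)] and [(2x, y, z)], read off the entries of [A] and [M], have
    vanishing 2-by-2 minors. They are therefore proportional, and the factor is obtained by dividing
    by a nonzero coordinate of [M]. *)
Lemma commute_trace0 A M : \tr M = 0 -> M != 0 -> A *m M = M *m A ->
  exists b, A = (\tr A / 2)%:M + b *: M.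
Proof.
move=> tM nM /matrixP cAM; have M11 := trace0E tM.
have e00 := cAM 0 0; have e01 := cAM 0 1; have e10 := cAM 1 0.
rewrite !mulmx2E M11 in e00 e01 e10.
have hb : [\/ M 0 0 != 0, M 0 1 != 0 | M 1 0 != 0].
  case: (mx2_neq0 nM); rewrite ?M11 ?oppr_eq0; by [constructor 1|constructor 2|constructor 3].
move: e00 e01 e10 M11; rewrite mxtrace2E.
set a := A 0 0; set b := A 0 1; set c := A 1 0; set d := A 1 1.
set x := M 0 0 in hb *; set y := M 0 1 in hb *; set z := M 1 0 in hb *.
move=> e00 e01 e10 M11.
have {e00}e00 : b * z = c * y.
  by apply/eqP; rewrite -subr_eq0; move/eqP: e00; rewrite -subr_eq0 => /eqP <-; apply/eqP; ring.
have {e01}e01 : (a - d) * y = 2 * x * b.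
  by apply/eqP; rewrite -subr_eq0; move/eqP: e01; rewrite -subr_eq0 => /eqP <-; apply/eqP; ring.
have {e10}e10 : (a - d) * z = 2 * x * c.
  apply/eqP; rewrite -subr_eq0; move/eqP: e10; rewrite -subr_eq0 -oppr_eq0 => /eqP <-.
  by apply/eqP; ring.
suff [k [k1 k2 k3]] : exists k, [/\ a - d = 2 * k * x, b = k * y & c = k * z].
  have ad : a = d + 2 * k * x by rewrite -k1; ring.
  by exists k; apply: mx2_eq; rewrite !mxE ?M11 -?/a -?/b -?/c -?/d -?/x -?/y -?/z /=
    ?mulr1n ?mulr0n ?add0r // ad; field.
case: hb => [nx|ny|nz].
- exists ((a - d) / (2 * x)); split; first by field; rewrite two_nz nx.
    by apply: (mulfI (mulf_neq0 two_nz nx)); rewrite -e01; field; rewrite two_nz nx.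
  by apply: (mulfI (mulf_neq0 two_nz nx)); rewrite -e10; field; rewrite two_nz nx.
- exists (b / y); split.
  + by apply: (mulIf ny); rewrite e01; field.
  + by field.
  + by apply: (mulIf ny); rewrite -e00; field.
- exists (c / z); split.
  + by apply: (mulIf nz); rewrite e10; field.
  + by apply: (mulIf nz); rewrite e00; field.
  + by field.
Qed.

Lemma det_trace0 M (a b : F) : \tr M = 0 -> \det (a%:M + b *: M) = a ^+ 2 - disc M * b ^+ 2.
Proof.
move=> tM; rewrite /disc !det2E !mxE (trace0E tM) /= !mulr1n !mulr0n; ring.
Qed.

Lemma mul_trace0 M (a b a' b' : F) : \tr M = 0 ->
  (a%:M + b *: M) *m (a'%:M + b' *: M) =
  (a * a' + b * b' * disc M)%:M + (a * b' + b * a') *: M.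
Proof.
move=> tM; apply: mx2_eq;
  by rewrite mulmx2E !mxE /disc det2E (trace0E tM) /= ?mulr1n ?mulr0n; ring.
Qed.

Lemma trace_trace0 M (a b : F) : \tr M = 0 -> \tr (a%:M + b *: M) = 2 * a.
Proof. by move=> tM; rewrite mxtraceD mxtraceZ tM mulr0 addr0 mxtrace_scalar mulr_natl. Qed.

Lemma discZ (c : F) M : disc (c *: M) = c ^+ 2 * disc M.
Proof. by rewrite /disc detZ mulrN. Qed.

Lemma trace0_lin_inj M (a b a' b' : F) : \tr M = 0 -> M != 0 ->
  a%:M + b *: M = a'%:M + b' *: M -> a = a' /\ b = b'.
Proof.
move=> tM nM E; have aa : a = a'.
  by apply: (mulfI two_nz); rewrite -(trace_trace0 a b tM) -(trace_trace0 a' b' tM) E.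
split=> //; move: E; rewrite aa => /addrI/eqP; rewrite -subr_eq0 -scalerBl scaler_eq0.
by rewrite (negPf nM) orbF subr_eq0 => /eqP.
Qed.

(* [1 + I + J + IJ] is twice a Hurwitz unit; conjugation by it permutes [I], [J]
   and [IJ] cyclically. *)
Lemma quaternion_rotator (I J W : 'M[F]_2) : \tr I = 0 -> \tr J = 0 ->
  I *m I = - 1%:M -> J *m J = - 1%:M -> J *m I = - (I *m J) ->
  W = 1%:M + (I + J + I *m J) ->
  [/\ W *m I = J *m W, I *m W = W *m (I *m J) & \det W = 4].
Proof.
move=> tI tJ II JJ JI WE.
have KI : I *m J *m I = J by rewrite -mulmxA JI mulmxN mulmxA II mulNmx mul1mx opprK.
have JK : J *m (I *m J) = I by rewrite mulmxA JI mulNmx -mulmxA JJ mulmxN mulmx1 opprK.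
have IK : I *m (I *m J) = - J by rewrite mulmxA II mulNmx mul1mx.
have KJ : I *m J *m J = - I by rewrite -mulmxA JJ mulmxN mulmx1.
have KK : I *m J *m (I *m J) = - 1%:M by rewrite -mulmxA JK II.
have tK : \tr (I *m J) = 0.
  have : \tr (J *m I) = \tr (I *m J) by rewrite mxtrace_mulC.
  rewrite JI raddfN /= => /eqP; rewrite eq_sym -subr_eq0 opprK -mulr2n -mulr_natl.
  by rewrite mulf_eq0 (negPf two_nz) => /eqP.
move: KI JK IK KJ KK tK JI WE; move IJ: (I *m J) => K KI JK IK KJ KK tK JI WE.
have tN : \tr (I + J + K) = 0 by rewrite !mxtraceD tI tJ tK !addr0.
split.
- rewrite WE !mulmxDl !mulmxDr mul1mx mulmx1 II JI KI JJ JK.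
  by apply/matrixP => i j; rewrite !mxE; ring.
- rewrite WE !mulmxDl !mulmxDr mul1mx mulmx1 II IJ IK JK KK.
  by apply/matrixP => i j; rewrite !mxE; ring.
have NN : (I + J + K) *m (I + J + K) = (- 3)%:M.
  rewrite !mulmxDl !mulmxDr II IJ IK JI JJ JK KI KJ KK.
  by apply/matrixP => i j; rewrite !mxE; case: (i == j); rewrite ?mulr1n ?mulr0n; ring.
have dN : disc (I + J + K) = - 3.
  by have /matrixP/(_ 0 0) := trace0_sq tN; rewrite NN !mxE /= !mulr1n.
rewrite WE -[I + J + K]scale1r det_trace0 // dN; ring.
Qed.

End TraceZero.

(** * Centralizers in PSL(2,p) *)

Section PSL2.

Variable p : nat.
Hypothesis p_pr : prime p.
Hypothesis p_gt7 : (7 < p)%N.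

Notation F := 'F_p.
Notation S := (SL_group p).
Notation Z := 'Z(SL_group p).
Implicit Types (g h : {'GL_2(p)}) (M A B : 'M[F]_2).

(** * SL(2,p), its center and equality of cosets *)

Lemma two_neq0 : (2 != 0 :> F)%R.
Proof.
rewrite -(dvdn_pcharf (pchar_Fp p_pr)); apply/negP => /dvdn_leq - /(_ isT).
by move: p_gt7; clear; lia.
Qed.

Lemma SLE g : (g \in S) = (\det (GLval g) == 1)%R.
Proof. by rewrite inE. Qed.

Definition GLof A : {'GL_2(p)} := insubd (1 : {'GL_2(p)}) A.

Lemma GLofK A : (\det A = 1)%R -> GLval (GLof A) = A.
Proof. by move=> dA; apply: insubdK; rewrite -topredE /= unitmxE dA unitr1. Qed.

Lemma GLof_SL A : (\det A = 1)%R -> GLof A \in S.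
Proof. by move=> dA; rewrite SLE GLofK // dA. Qed.

Lemma GLval_inj : injective (fun g : {'GL_2(p)} => GLval g).
Proof. exact: val_inj. Qed.

Lemma GLvalM g h : GLval (g * h) = (GLval g *m GLval h)%R.
Proof. exact: GL_MxE. Qed.

Lemma GLval1 : GLval (1 : {'GL_2(p)}) = 1%:M%R.
Proof. exact: GL_1E. Qed.

Lemma SL_det g : g \in S -> (\det (GLval g) = 1)%R.
Proof. by rewrite SLE => /eqP. Qed.

Lemma GLof_commute g A : (\det A = 1)%R -> commute g (GLof A) ->
  (GLval g *m A = A *m GLval g)%R.
Proof.
move=> dA cgA.
have e1 : (GLval (g * GLof A)%g = GLval g *m A)%R by rewrite GLvalM (GLofK dA).
have e2 : (GLval (GLof A * g)%g = A *m GLval g)%R by rewrite GLvalM (GLofK dA).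
by rewrite -e1 -e2 cgA.
Qed.

(** Commuting with the upper and the lower elementary transvection already forces a matrix to be
    scalar. *)
Lemma mem_center g : (g \in Z) = (g \in S) && [exists a, GLval g == (a%:M)%R].
Proof.
apply/idP/andP => [Zg|[Sg /existsP[a /eqP ga]]]; last first.
  apply/centerP; split=> // h Sh; apply: GLval_inj.
  by rewrite !GLvalM ga scalar_mxC.
have /centerP[Sg cg] := Zg; split=> //.
have E12 : (\det (mx2 1 1 0 1 : 'M[F]_2) = 1)%R.
  by rewrite det2E; case: (mx2K 1 1 0 (1 : F))%R => -> -> -> ->; ring.
have E21 : (\det (mx2 1 0 1 1 : 'M[F]_2) = 1)%R.
  by rewrite det2E; case: (mx2K 1 0 1 (1 : F))%R => -> -> -> ->; ring.
have c1 := GLof_commute E12 (cg _ (GLof_SL E12)).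
have c2 := GLof_commute E21 (cg _ (GLof_SL E21)).
move/matrixP: c1 => c1; move/matrixP: c2 => c2.
have := c1 0%R 0%R; have := c1 0%R 1%R; have := c2 0%R 0%R.
rewrite !mulmx2E !mxE /=.
rewrite !(mulr0, mul0r, mulr1, mul1r, addr0, add0r) => h1 h2 h3.
apply/existsP; exists (GLval g 0%R 0%R); apply/eqP.
have g01 : (GLval g 0 1 = 0)%R by apply: (addrI (GLval g 0 0)%R); rewrite addr0.
have g10 : (GLval g 1 0 = 0)%R by apply: (addrI (GLval g 0 0)%R); rewrite addr0.
by apply: mx2_eq; rewrite !mxE /= ?mulr1n ?mulr0n //; move: h2; rewrite g01 ?addr0 ?add0r.
Qed.

Local Open Scope ring_scope.

Lemma det_opp1 : \det (- 1%:M : 'M[F]_2) = 1.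
Proof. by rewrite det2E !mxE /= !mulr1n !mulr0n; ring. Qed.

Lemma scalarN1 : (-1)%:M = - 1%:M :> 'M[F]_2.
Proof. exact: raddfN. Qed.

Lemma center_cases g : g \in S -> (g \in Z) = (GLval g == 1%:M) || (GLval g == - 1%:M).
Proof.
move=> Sg; rewrite mem_center Sg /=; apply/existsP/orP => [[a /eqP ga]|].
  have /eqP := SL_det Sg; rewrite ga det_scalar sqrf_eq1.
  by case/orP => /eqP->; [left|right]; rewrite ?scalarN1 eqxx.
by case=> /eqP->; [exists 1|exists (-1)]; rewrite ?scalarN1.
Qed.

Lemma card_center : #|Z| = 2%N.
Proof.
have -> : Z = [set 1%g; GLof (- 1%:M)] :> {set _}.
  apply/setP => g; rewrite in_set2; have [Sg|nSg] := boolP (g \in S).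
    rewrite center_cases // -GLval1 -[in LHS](GLofK det_opp1).
    by rewrite !(inj_eq GLval_inj).
  rewrite mem_center (negPf nSg); apply/esym/norP; split.
    by apply: contraNneq nSg => ->; apply: group1.
  by apply: contraNneq nSg => ->; rewrite GLof_SL ?det_opp1.
suff n1 : 1%g != GLof (- 1%:M) by rewrite cards2 n1.
apply/eqP => /(congr1 (fun g : {'GL_2(p)} => GLval g)).
rewrite GLval1 GLofK ?det_opp1 // => /matrixP/(_ 0 0); rewrite !mxE mulr1n => /eqP.
by apply/negP; apply: (neq_opp two_neq0); exact: oner_neq0.
Qed.

Lemma SL_normZ g : g \in S -> g \in 'N(Z)%g.
Proof. by apply: subsetP; rewrite normal_norm // center_normal. Qed.

Lemma PSL_lift x : x \in PSL p -> exists2 g, g \in S & x = coset Z g.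
Proof. by case/morphimP => g _ Sg ->; exists g. Qed.

Lemma coset_PSL g : g \in S -> coset Z g \in PSL p.
Proof. by move=> Sg; rewrite mem_quotient. Qed.

Lemma coset_eq g h : g \in S -> h \in S ->
  (coset Z g == coset Z h) = (GLval g == GLval h) || (GLval g == - GLval h).
Proof.
move=> Sg Sh; have [Ng Nh] := (SL_normZ Sg, SL_normZ Sh).
have Sgh := groupM Sg (groupVr Sh).
have -> : (coset Z g == coset Z h) = (g * h^-1 \in Z)%g.
  by rewrite (sameP eqP (rcoset_kercosetP Ng Nh)) mem_rcoset.
rewrite (center_cases Sgh).
have E (c : F) : (GLval (g * h^-1)%g == c%:M) = (GLval g == c%:M *m GLval h).
  apply/eqP/eqP => [<-|gE]; first by rewrite -GLvalM mulgKV.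
  have hh : GLval h *m GLval h^-1%g = 1%:M by rewrite -GLvalM mulgV GLval1.
  by rewrite GLvalM gE -mulmxA hh mulmx1.
by rewrite -scalarN1 !E mul1mx scalarN1 mulNmx mul1mx.
Qed.

Lemma coset_eq1 g : g \in S -> (coset Z g == 1%g) = (g \in Z).
Proof.
move=> Sg; apply/eqP/idP => [/coset_idr|]; last exact: coset_id.
by apply; apply: SL_normZ.
Qed.

(** * Cells as images of centralizers *)

Lemma cent_group_set M : group_set [set g in S | GLval g *m M == M *m GLval g].
Proof.
apply/group_setP; split; first by rewrite inE group1 GLval1 mul1mx mulmx1 /=.
move=> g h; rewrite !inE -!SLE => /andP[Sg /eqP cg] /andP[Sh /eqP ch].
by rewrite groupM // GLvalM -mulmxA ch !mulmxA cg eqxx.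
Qed.

Definition centr M := Group (cent_group_set M).
Definition cell M := (centr M / Z)%G.

Lemma mem_centr M g : (g \in centr M) = (g \in S) && (GLval g *m M == M *m GLval g).
Proof. by rewrite inE. Qed.

Lemma centr_sub M : centr M \subset S.
Proof. by apply/subsetP => g; rewrite mem_centr => /andP[]. Qed.

Lemma center_sub_centr M : Z \subset centr M.
Proof.
apply/subsetP => g; rewrite mem_center mem_centr => /andP[-> /existsP[a /eqP ->]].
by rewrite scalar_mxC eqxx.
Qed.

Lemma mem_cell M g : g \in S -> (coset Z g \in cell M) = (g \in centr M).
Proof.
move=> Sg; apply/idP/idP => [|Cg]; last by rewrite mem_quotient.
case/morphimP => h Nh Ch /(rcoset_kercosetP (SL_normZ Sg) Nh) /rcosetP[z Zz ->].
by rewrite groupM // (subsetP (center_sub_centr M)).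
Qed.

Lemma cell_subPSL M : cell M \subset PSL p.
Proof. exact: quotientS (centr_sub M). Qed.

Lemma card_cell M : (#|cell M| * 2)%N = #|centr M|.
Proof.
have nZ := subset_trans (centr_sub M) (normal_norm (center_normal S)).
by rewrite -(Lagrange (center_sub_centr M)) card_center mulnC -(card_quotient nZ).
Qed.

Definition tracezero := [set M : 'M[F]_2 | (\tr M == 0) && (M != 0)].

Lemma tracezeroP M : reflect (\tr M = 0 /\ M != 0) (M \in tracezero).
Proof. by rewrite inE; apply: (iffP andP) => -[/eqP]. Qed.

Lemma centr_form M g : M \in tracezero -> g \in centr M ->
  exists b, GLval g = (\tr (GLval g) / 2)%:M + b *: M.
Proof.
move=> /tracezeroP[tM nM]; rewrite mem_centr => /andP[_ /eqP cg].
exact: (commute_trace0 two_neq0 tM nM cg).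
Qed.

Lemma centrZ (c : F) M : c != 0 -> centr (c *: M) = centr M.
Proof.
move=> nc; apply: val_inj; apply/setP => g; rewrite !mem_centr -scalemxAl -scalemxAr.
by rewrite (inj_eq (scalerI nc)).
Qed.

Lemma cellZ (c : F) M : c != 0 -> cell (c *: M) = cell M.
Proof. by move=> nc; rewrite /cell centrZ. Qed.

Lemma centr_form_nz M g : M \in tracezero -> g \in centr M -> g \notin Z ->
  exists b, b != 0 /\ GLval g = (\tr (GLval g) / 2)%:M + b *: M.
Proof.
move=> TM Cg nZg; have [b gE] := centr_form TM Cg; exists b; split=> //.
apply: contra nZg => /eqP b0; rewrite mem_center (subsetP (centr_sub M)) //=.
by apply/existsP; exists (\tr (GLval g) / 2); rewrite {1}gE b0 scale0r addr0.
Qed.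

(** The trace-free part of a noncentral [g] is a nonzero multiple of both [M] and [M']. Cells thus
    correspond to lines of trace-zero matrices and meet trivially. *)
Lemma centr_proportional M M' g : M \in tracezero -> M' \in tracezero ->
  g \in centr M -> g \in centr M' -> g \notin Z -> exists2 c, c != 0 & M' = c *: M.
Proof.
move=> TM TM' Cg Cg' nZg.
have [b [nb gE]] := centr_form_nz TM Cg nZg.
have [b' [nb' gE']] := centr_form_nz TM' Cg' nZg.
exists (b'^-1 * b); first by rewrite mulf_neq0 // invr_neq0.
apply: (scalerI nb'); rewrite scalerA mulrA mulfV // mul1r.
by apply: (addrI (\tr (GLval g) / 2)%:M); rewrite -gE' -gE.
Qed.

Lemma cell_TI_PSL M M' x : M \in tracezero -> M' \in tracezero ->
  x \in cell M -> x \in cell M' -> x != 1%g -> cell M = cell M'.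
Proof.
move=> TM TM' Mx; have [g Sg xE] := PSL_lift (subsetP (cell_subPSL M) _ Mx).
move: Mx; rewrite xE !mem_cell // coset_eq1 // => Cg Cg' nZ.
by have [c nc ->] := centr_proportional TM TM' Cg Cg' nZ; rewrite cellZ.
Qed.

Lemma cell_cover_PSL x : x \in PSL p -> x != 1%g ->
  exists2 M, M \in tracezero & x \in cell M.
Proof.
case/PSL_lift => g Sg ->; rewrite coset_eq1 // => nZg.
(* [M] is the trace-free part of [g]; it commutes with [g] and vanishes only for scalar [g]. *)
pose M := GLval g - (\tr (GLval g) / 2)%:M.
have tM : \tr M = 0.
  have half2 (t : F) : t / 2 *+ 2 = t by field; apply: two_neq0.
  by rewrite /M raddfB /= mxtrace_scalar half2 subrr.
exists M; last first.
  by rewrite mem_cell // mem_centr Sg /M mulmxBl mulmxBr scalar_mxC eqxx.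
rewrite inE tM eqxx /=; apply: contra nZg; rewrite subr_eq0 => gs.
by rewrite mem_center Sg; apply/existsP; exists (\tr (GLval g) / 2).
Qed.

(** * Conjugation of cells *)

Definition mxconj M g := GLval g^-1%g *m M *m GLval g.

Lemma GLvalK g : GLval g *m GLval g^-1%g = 1%:M.
Proof. by rewrite -GLvalM mulgV GLval1. Qed.

Lemma GLvalVK g : GLval g^-1%g *m GLval g = 1%:M.
Proof. by rewrite -GLvalM mulVg GLval1. Qed.

Lemma mulGLK g A : GLval g *m (GLval g^-1%g *m A) = A.
Proof. by rewrite mulmxA GLvalK mul1mx. Qed.

Lemma mulGLVK g A : GLval g^-1%g *m (GLval g *m A) = A.
Proof. by rewrite mulmxA GLvalVK mul1mx. Qed.

Lemma mxconj_disc M g : disc (mxconj M g) = disc M.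
Proof.
rewrite /disc /mxconj !det_mulmx mulrAC -det_mulmx GLvalVK.
by rewrite det1 mul1r.
Qed.

Lemma mxconj_tracezero M g : M \in tracezero -> mxconj M g \in tracezero.
Proof.
case/tracezeroP => tM nM; apply/tracezeroP; split.
  by rewrite /mxconj mxtrace_mulC mulmxA GLvalK mul1mx.
apply: contra nM => /eqP E.
have <- : GLval g *m mxconj M g *m GLval g^-1%g = M.
  by rewrite /mxconj !mulmxA GLvalK mul1mx -mulmxA GLvalK mulmx1.
by rewrite E mulmx0 mul0mx.
Qed.

Lemma mxconjE M g B : (mxconj M g == B) = (M *m GLval g == GLval g *m B).
Proof.
apply/eqP/eqP => [<-|E]; first by rewrite /mxconj !mulmxA GLvalK mul1mx.
by rewrite /mxconj -mulmxA E mulmxA GLvalVK mul1mx.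
Qed.

Lemma centr_conj M g : g \in S -> (centr M :^ g)%G = centr (mxconj M g).
Proof.
move=> Sg; apply: val_inj; apply/setP => h /=; rewrite mem_conjg !mem_centr.
rewrite (groupJr h (groupVr Sg)); congr andb.
have -> : GLval (h ^ g^-1)%g = GLval g *m (GLval h *m GLval g^-1%g).
  by rewrite conjgE invgK GLvalM GLvalM.
exact: (conj_commute_eq (GLval h) M (GLvalK g) (GLvalVK g)).
Qed.

Lemma cell_conj_PSL M g : g \in S -> (cell M :^ coset Z g)%G = cell (mxconj M g).
Proof.
move=> Sg; apply: val_inj; rewrite /= -quotientJ ?SL_normZ //.
by rewrite -[(centr M :^ g)%g]/(gval (centr M :^ g)%G) centr_conj.
Qed.

(** * Sizes and numbers of cells *)

Lemma card_F : #|F| = p.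
Proof. exact: card_Fp. Qed.

(** The centralizer consists of the matrices [a + b M] of determinant [a^2 - disc M * b^2 = 1], so
    its elements are the points of a conic. *)
Lemma card_centr M : M \in tracezero ->
  #|centr M| = #|[set ab : F * F | ab.1 ^+ 2 - disc M * ab.2 ^+ 2 == 1]|.
Proof.
move=> TM; have /tracezeroP[tM nM] := TM.
pose f (ab : F * F) := GLof (ab.1%:M + ab.2 *: M).
have dE ab : ab \in [set ab : F * F | ab.1 ^+ 2 - disc M * ab.2 ^+ 2 == 1] ->
    \det (ab.1%:M + ab.2 *: M) = 1.
  by rewrite inE det_trace0 // => /eqP.
rewrite -(card_in_imset (f := f)) => [|ab cd Dab Dcd E]; last first.
  have fK xy : xy \in [set ab : F * F | ab.1 ^+ 2 - disc M * ab.2 ^+ 2 == 1] ->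
      GLval (f xy) = xy.1%:M + xy.2 *: M by move=> /dE dxy; apply: GLofK.
  have := etrans (esym (fK ab Dab)) (etrans (congr1 (fun g => GLval g) E) (fK cd Dcd)).
  case/(trace0_lin_inj two_neq0 tM nM) => e1 e2.
  by case: (ab) (cd) e1 e2 => [a b] [c d] /= -> ->.
apply: eq_card => g; apply/idP/imsetP => [Cg|[ab Dab ->]].
  have [b gE] := centr_form TM Cg; exists (\tr (GLval g) / 2, b).
    rewrite inE /= -det_trace0 // -gE SL_det ?eqxx //.
    exact: subsetP (centr_sub M) _ Cg.
  by apply: GLval_inj; rewrite /f GLofK /= -gE // SL_det // (subsetP (centr_sub M)).
rewrite mem_centr GLof_SL ?dE //= GLofK ?dE // mulmxDl mulmxDr scalar_mxC.
by rewrite -scalemxAl -scalemxAr.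
Qed.

Lemma card_centr_split M : M \in tracezero -> disc M != 0 -> issquare (disc M) ->
  #|centr M| = p.-1.
Proof.
move=> TM nd /issquareP[s sd]; rewrite card_centr // -sd.
by rewrite (card_conic_split two_neq0) ?card_F // -sqrf_eq0 sd.
Qed.

Lemma card_centr_nonsplit M : M \in tracezero -> ~~ issquare (disc M) ->
  #|centr M| = p.+1.
Proof.
by move=> TM ns; rewrite card_centr // (card_conic_nonsplit two_neq0) ?card_F.
Qed.

Lemma card_centr_unip M : M \in tracezero -> disc M = 0 -> #|centr M| = (2 * p)%N.
Proof.
move=> TM d0; rewrite card_centr // d0.
have := card_conic0 two_neq0; rewrite card_F => <-.
by apply: eq_card => -[a b]; rewrite !inE mul0r subr0.
Qed.

Lemma card_centr_gt2 M : M \in tracezero -> (2 < #|centr M|)%N.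
Proof.
move=> TM; have [d0|nd] := eqVneq (disc M) 0.
  by rewrite card_centr_unip //; move: p_gt7; clear; lia.
have [sq|nsq] := boolP (issquare (disc M)).
  by rewrite card_centr_split //; move: p_gt7; clear; lia.
by rewrite card_centr_nonsplit //; move: p_gt7; clear; lia.
Qed.

Lemma centr_noncentral M : M \in tracezero -> exists2 g, g \in centr M & g \notin Z.
Proof.
move=> TM; apply/subsetPn/negP => /subset_leq_card.
by rewrite leqNgt card_center card_centr_gt2.
Qed.

Lemma cell_proportional M M' : M \in tracezero -> M' \in tracezero ->
  cell M = cell M' -> exists2 c, c != 0 & M' = c *: M.
Proof.
move=> TM TM' E; have [g Cg nZg] := centr_noncentral TM.
have Sg := subsetP (centr_sub M) _ Cg.
apply: (centr_proportional TM TM' Cg _ nZg).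
by rewrite -mem_cell // -E mem_cell.
Qed.

Definition unips := cell @: [set M in tracezero | disc M == 0].
Definition splits := cell @: [set M in tracezero | (disc M != 0) && issquare (disc M)].
Definition nonsplits := cell @: [set M in tracezero | ~~ issquare (disc M)].

Lemma card_disc (d : F) : #|[set M : 'M[F]_2 | (\tr M == 0) && (disc M == d)]| =
  (p * p.-1 + p * (if d == 0%R then 1 else if issquare d then 2 else 0))%N.
Proof.
have := card_quadric two_neq0 d; rewrite card_F (card_sqrt two_neq0) => <-.
pose f (t : F * (F * F)) := mx2 t.1 t.2.1 t.2.2 (- t.1).
have fi : injective f.
  move=> [x [y z]] [x' [y' z']] /matrixP E.
  by move: (E 0 0) (E 0 1) (E 1 0); rewrite !mxE /= => -> -> ->.
rewrite -(card_imset _ fi); apply: eq_card => M; rewrite inE; apply/andP/imsetP.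
  case=> /eqP tM /eqP dM; exists (M 0 0, (M 0 1, M 1 0)).
    by rewrite inE /= -dM /disc det2E (trace0E tM); apply/eqP; ring.
  by apply: mx2_eq; rewrite !mxE //= (trace0E tM).
case=> -[x [y z]]; rewrite inE => /eqP <- -> /=.
split; first by rewrite mxtrace2E !mxE /= subrr.
by rewrite /disc det2E !mxE /=; apply/eqP; ring.
Qed.

Lemma card_tracezero_disc (d : F) : d != 0 -> #|[set M in tracezero | disc M == d]| =
  (p * p.-1 + p * (if issquare d then 2 else 0))%N.
Proof.
move=> nd; have := card_disc d; rewrite (negPf nd) => <-.
apply: eq_card => M; rewrite !inE -andbA; congr (_ && _).
have [->|//] := eqVneq M 0; apply/esym/negbTE.
by rewrite /disc det2E !mxE mul0r subr0 oppr0 eq_sym.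
Qed.

(** Scaling [M] by [c] multiplies [disc M] by [c^2], so exactly [M] and [- M] represent the same
    cell with the same nonzero [disc]. *)
Lemma card_cells_disc (d : F) : d != 0 ->
  (#|cell @: [set M in tracezero | disc M == d]| * 2 =
   p * p.-1 + p * (if issquare d then 2 else 0))%N.
Proof.
move=> nd; rewrite -card_tracezero_disc //; apply/esym/card_fibers => M.
rewrite inE => /andP[TM /eqP dM]; have nM : M != 0 by case/tracezeroP: TM.
have -> : [set B in [set M in tracezero | disc M == d] | cell B == cell M] = [set M; - M].
  apply/setP => B; rewrite !in_set2 inE; apply/andP/orP => [[]|].
    rewrite inE => /andP[TB /eqP dB] /eqP/esym E.
    have [c nc BE] := cell_proportional TM TB E.
    have : c ^+ 2 * d = 1 * d by rewrite mul1r -{1}dM -discZ -BE.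
    move/(mulIf nd)/eqP; rewrite sqrf_eq1 BE => /orP[] /eqP->.
      by left; rewrite scale1r.
    by right; rewrite scaleN1r.
  case=> /eqP->; rewrite ?eqxx inE ?TM ?dM ?eqxx //.
  have dN : disc (- M) = d by rewrite -scaleN1r discZ sqrrN expr1n mul1r.
  have -> : cell (- M) = cell M by rewrite -scaleN1r cellZ // oppr_eq0 oner_eq0.
  rewrite dN !eqxx andbT; split=> //; move: TM; rewrite !inE raddfN /= !oppr_eq0.
  by move=> ->.
rewrite cards2; suff -> : M != - M by [].
have [|||] := mx2_neq0 nM => nz; apply/eqP => /matrixP E.
- by have := E 0 0; rewrite !mxE => /eqP; apply/negP/(neq_opp two_neq0).
- by have := E 0 1; rewrite !mxE => /eqP; apply/negP/(neq_opp two_neq0).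
- by have := E 1 0; rewrite !mxE => /eqP; apply/negP/(neq_opp two_neq0).
- by have := E 1 1; rewrite !mxE => /eqP; apply/negP/(neq_opp two_neq0).
Qed.

Lemma tracezeroZ (c : F) M : c != 0 -> M \in tracezero -> c *: M \in tracezero.
Proof.
move=> nc /tracezeroP[tM nM]; apply/tracezeroP; rewrite mxtraceZ tM mulr0; split=> //.
by rewrite scaler_eq0 negb_or nc.
Qed.

(** Dividing [M] by a square root of [disc M] represents every split torus with [disc] equal to
    1. *)
Lemma card_splits : (#|splits| * 2 = p * p.+1)%N.
Proof.
have sq1 : issquare (1 : F) by apply/issquareP; exists 1; rewrite expr1n.
have -> : splits = cell @: [set M in tracezero | disc M == 1].
  apply/setP => C; apply/imsetP/imsetP => -[M]; rewrite inE => /andP[TM].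
    case/andP => nd /issquareP[s sd] ->.
    have ns : s != 0 by rewrite -sqrf_eq0 sd.
    exists (s^-1 *: M); last by rewrite cellZ // invr_eq0.
    by rewrite inE tracezeroZ ?invr_eq0 // discZ -sd -exprMn mulVf // expr1n eqxx.
  by move=> /eqP d1 ->; exists M; rewrite // inE TM d1 oner_eq0.
rewrite card_cells_disc ?oner_eq0 // sq1 -mulnDr; congr (_ * _)%N.
by move: p_gt7; clear; lia.
Qed.

Lemma card_nonsplits : (#|nonsplits| * 2 = p * p.-1)%N.
Proof.
have [d nsd] := nonsquare_ex two_neq0.
have nd : d != 0 by apply: contra nsd => /eqP->; apply/issquareP; exists 0; rewrite expr0n.
have -> : nonsplits = cell @: [set M in tracezero | disc M == d].
  apply/setP => C; apply/imsetP/imsetP => -[M]; rewrite inE => /andP[TM].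
    move=> ns ->; have [c nc dE] := nonsquare_ratio two_neq0 ns nsd.
    by exists (c *: M); rewrite ?cellZ // inE tracezeroZ // discZ dE eqxx.
  by move=> /eqP dE ->; exists M; rewrite // inE TM dE.
by rewrite card_cells_disc // (negPf nsd) muln0 addn0.
Qed.

(** There are [p^2 - 1] nonzero matrices with zero trace and zero [disc], and each cell comes from
    the [p - 1] nonzero multiples of one of them. *)
Lemma card_unips : #|unips| = p.+1.
Proof.
have p1 : (0 < p.-1)%N by move: p_gt7; clear; lia.
apply/eqP; rewrite -(eqn_pmul2r p1); apply/eqP.
have <- : #|[set M in tracezero | disc M == 0]| = (p.+1 * p.-1)%N.
  have := card_disc 0; rewrite eqxx (cardsD1 0) inE mxtrace0 eqxx /=.
  rewrite /disc det2E !mxE mul0r subr0 oppr0 eqxx => E.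
  have -> : [set M in tracezero | - \det M == 0] =
      [set M : 'M[F]_2 | (\tr M == 0) && (- \det M == 0)] :\ 0.
    by apply/setP => M; rewrite !inE; case: (M == 0); rewrite ?andbF ?andbT.
  by move: E p_gt7; move: #|_| => n; clear; nia.
apply/esym/card_fibers => M; rewrite inE => /andP[TM /eqP dM].
have nM : M != 0 by case/tracezeroP: TM.
have sI : injective (fun c : F => c *: M).
  by move=> c c' /eqP; rewrite -subr_eq0 -scalerBl scaler_eq0 (negPf nM) orbF subr_eq0 => /eqP.
have := card_imset [set~ (0 : F)] sI; rewrite cardsC1 card_F => <-.
apply: eq_card => B.
rewrite inE; apply/andP/imsetP => [[]|[c]].
  rewrite inE => /andP[TB _] /eqP/esym/(cell_proportional TM TB)[c nc ->].
  by exists c; rewrite // !inE.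
rewrite !in_setC1 => nc ->; rewrite cellZ // eqxx inE tracezeroZ // discZ dM mulr0.
by rewrite eqxx.
Qed.

(** * Checking the hypotheses of the abstract count *)

Lemma cell_typesP C : C \in unips :|: (splits :|: nonsplits) ->
  exists2 M, M \in tracezero & C = cell M.
Proof.
by rewrite !in_setU => /or3P[] /imsetP[M]; rewrite inE => /andP[TM _] ->; exists M.
Qed.

Lemma torus_typesP C : C \in splits :|: nonsplits ->
  exists M, [/\ M \in tracezero, disc M != 0 & C = cell M].
Proof.
rewrite in_setU => /orP[] /imsetP[M]; rewrite inE => /andP[TM].
  by case/andP => nd _ ->; exists M.
move=> ns ->; exists M; split=> //; apply: contra ns => /eqP->.
by apply/issquareP; exists 0; rewrite expr0n.
Qed.

Lemma cell_types M : M \in tracezero -> cell M \in unips :|: (splits :|: nonsplits).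
Proof.
move=> TM; rewrite !in_setU; have [d0|nd] := eqVneq (disc M) 0.
  by apply/or3P; constructor 1; apply: imset_f; rewrite inE TM d0 eqxx.
have [sq|nsq] := boolP (issquare (disc M)); apply/or3P.
  by constructor 2; apply: imset_f; rewrite inE TM nd sq.
by constructor 3; apply: imset_f; rewrite inE TM nsq.
Qed.

Lemma cell_imset_conj (P : pred F) C x : x \in PSL p ->
  C \in cell @: [set M in tracezero | P (disc M)] ->
  (C :^ x)%G \in cell @: [set M in tracezero | P (disc M)].
Proof.
case/PSL_lift => g Sg -> /imsetP[M]; rewrite inE => /andP[TM PM] ->.
by rewrite cell_conj_PSL // imset_f // inE mxconj_tracezero ?mxconj_disc.
Qed.

(** Conjugation by a lift [g] sends [M] to [c *: M], and preserving [disc M] gives [c = 1] or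
    [c = -1]. The first puts [g] in the centralizer. In the second [g] anticommutes with [M], so it
    has trace 0 and Cayley-Hamilton gives [g^2 = -1], which is central. *)
Lemma torus_norm_PSL T x : T \in splits :|: nonsplits ->
  x \in 'N_(PSL p)(T)%g -> x \notin T -> (x ^+ 2)%g = 1%g.
Proof.
case/torus_typesP => M [TM nd ->] /setIP[/PSL_lift[g Sg ->]] NT nTg.
have [tM nM] := tracezeroP _ TM.
have /esym E : cell (mxconj M g) = cell M.
  by rewrite -cell_conj_PSL //; apply: val_inj; apply/normP.
have [c nc cE] := cell_proportional TM (mxconj_tracezero g TM) E.
have : c ^+ 2 * disc M = 1 * disc M by rewrite -discZ -cE mxconj_disc mul1r.
move/(mulIf nd)/eqP; rewrite sqrf_eq1 => /orP[] /eqP c1.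
  case/negP: nTg; rewrite mem_cell // mem_centr Sg eq_sym.
  by rewrite -mxconjE cE c1 scale1r eqxx.
have gM : M *m GLval g = - (GLval g *m M).
  by apply/eqP; rewrite -mulmxN -mxconjE cE c1 scaleN1r.
have tg : \tr (GLval g) = 0.
  have t1 : \tr (M *m (M *m GLval g)) = disc M * \tr (GLval g).
    by rewrite mulmxA trace0_sq // mul_scalar_mx mxtraceZ.
  have t2 : \tr (M *m (M *m GLval g)) = - (disc M * \tr (GLval g)).
    rewrite gM mulmxN raddfN /= mulmxA mxtrace_mulC mulmxA trace0_sq //.
    by rewrite mul_scalar_mx mxtraceZ.
  apply/eqP/negPn/negP => nt; have nn := mulf_neq0 nd nt.
  by have := neq_opp two_neq0 nn; rewrite -{1}t1 t2 eqxx.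
have -> : (coset Z g ^+ 2 = coset Z (g ^+ 2))%g by rewrite morphX ?SL_normZ.
have g2 : GLval (g ^+ 2)%g = - 1%:M.
  rewrite (_ : g ^+ 2 = g * g)%g // GLvalM mx2_cayley tg scale0r sub0r.
  by rewrite SL_det.
apply/eqP; rewrite coset_eq1; last exact: groupX.
by rewrite center_cases; [rewrite g2 eqxx orbT|exact: groupX].
Qed.

(** Multiplying by [M] and taking the trace isolates the coefficient of [M]. This makes it a
    function of [g], as the embedding of the centralizer into a field requires. *)
Lemma centr_coords M g : M \in tracezero -> disc M != 0 -> g \in centr M ->
  GLval g = (\tr (GLval g) / 2)%:M + (\tr (GLval g *m M) / (2 * disc M)) *: M.
Proof.
move=> TM nd Cg; have [b gE] := centr_form TM Cg; have [tM nM] := tracezeroP _ TM.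
suff <- : b = \tr (GLval g *m M) / (2 * disc M) by [].
rewrite gE mulmxDl mxtraceD mul_scalar_mx mxtraceZ tM mulr0 add0r.
rewrite -scalemxAl trace0_sq // mxtraceZ mxtrace_scalar.
by rewrite /=; field; rewrite nd two_neq0.
Qed.

(* [a + b M |-> a + b s] with [s ^ 2 = disc M] embeds the centralizer of [M] in
   the multiplicative group of a field. *)
Lemma centr_cyclic M : M \in tracezero -> disc M != 0 -> cyclic (centr M).
Proof.
move=> TM nd; have [tM nM] := tracezeroP _ TM.
have [K [iota _]] := countable_algebraic_closure F.
have [s sd] : exists s : K, s ^+ 2 = iota (disc M).
  have : size ('X^2 - (iota (disc M))%:P : {poly K}) != 1%N by rewrite size_XnsubC.
  case/closed_rootP => s; rewrite rootE !hornerE subr_eq0 => /eqP <-.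
  by exists s.
pose a g := \tr (GLval g) / 2; pose b g := \tr (GLval g *m M) / (2 * disc M).
have gE g : g \in centr M -> GLval g = (a g)%:M + b g *: M by apply: centr_coords.
have [a1 b1] : a 1%g = 1 /\ b 1%g = 0.
  rewrite /a /b GLval1 mul1mx tM mul0r mxtrace_scalar divff //; exact: two_neq0.
clearbody a b.
have ns : s != 0 by rewrite -sqrf_eq0 sd fmorph_eq0.
have two_K : 2 != 0 :> K.
  by rewrite -(rmorph_nat iota 2) fmorph_eq0 two_neq0.
apply: (@field_mul_group_cyclic _ (centr M) K (fun g => iota (a g) + s * iota (b g))).
  move=> g h Cg Ch; have ghE : (a (g * h)%g)%:M + b (g * h)%g *: M =
      (a g * a h + b g * b h * disc M)%:M + (a g * b h + b g * a h) *: M.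
    by rewrite -gE ?groupM // GLvalM (gE g) // (gE h) // mul_trace0.
  have [-> ->] := trace0_lin_inj two_neq0 tM nM ghE.
  by rewrite !(rmorphD, rmorphM) /= -sd; ring.
move=> g Cg; split=> [f1|->]; last first.
  by rewrite a1 b1 rmorph0 mulr0 addr0 rmorph1.
have Sg := subsetP (centr_sub M) _ Cg.
have dg : a g ^+ 2 - disc M * b g ^+ 2 = 1 by rewrite -det_trace0 // -gE // SL_det.
have f2 : iota (a g) - s * iota (b g) = 1.
  rewrite -[RHS](rmorph1 iota) -dg rmorphB rmorphXn rmorphM rmorphXn /= -sd.
  by rewrite -exprMn subr_sqr f1 mulr1.
have ag1 : a g = 1.
  apply: (fmorph_inj iota); rewrite rmorph1; apply: (mulfI two_K).
  have -> : 2 * iota (a g) = (iota (a g) + s * iota (b g)) + (iota (a g) - s * iota (b g)).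
    by ring.
  by rewrite f1 f2; ring.
have bg0 : b g = 0.
  apply: (fmorph_inj iota); rewrite rmorph0; apply: (mulfI ns); rewrite mulr0.
  by move: f1; rewrite ag1 rmorph1 -[RHS]addr0 => /addrI.
by apply: GLval_inj; rewrite (gE g) // ag1 bg0 scale0r addr0 GLval1.
Qed.

Lemma torus_cyclic_PSL T : T \in splits :|: nonsplits -> cyclic T.
Proof. by case/torus_typesP => M [TM nd ->]; apply/quotient_cyclic/centr_cyclic. Qed.

Lemma mem_norm_cell M g (c : F) : g \in S -> c != 0 ->
  M *m GLval g = GLval g *m (c *: M) -> coset Z g \in 'N(cell M)%g.
Proof.
move=> Sg nc /eqP; rewrite -mxconjE => /eqP E; apply/normP.
by have /congr_group := cell_conj_PSL M Sg; rewrite E cellZ.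
Qed.

Lemma borel_ex_PSL : exists T U1 U2, [/\ T \in splits, U1 \in unips, U2 \in unips,
  U1 != U2 & T \subset 'N(U1)%g :&: 'N(U2)%g].
Proof.
(* [cell D] is the diagonal torus; [E] and [E'] span the strictly upper and strictly lower
   triangular matrices, whose cells the diagonal torus normalizes. *)
pose D : 'M[F]_2 := mx2 1 0 0 (-1); pose E : 'M[F]_2 := mx2 0 1 0 0.
pose E' : 'M[F]_2 := mx2 0 0 1 0.
have TD : D \in tracezero.
  apply/tracezeroP; split; first by rewrite mxtrace2E !mxE /= subrr.
  by apply/eqP => /matrixP/(_ 0 0); rewrite !mxE /=; apply/eqP/oner_neq0.
have TE : E \in tracezero.
  apply/tracezeroP; split; first by rewrite mxtrace2E !mxE /= addr0.
  by apply/eqP => /matrixP/(_ 0 1); rewrite !mxE /=; apply/eqP/oner_neq0.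
have TE' : E' \in tracezero.
  apply/tracezeroP; split; first by rewrite mxtrace2E !mxE /= addr0.
  by apply/eqP => /matrixP/(_ 1 0); rewrite !mxE /=; apply/eqP/oner_neq0.
have dD : disc D = 1 by rewrite /disc det2E !mxE /=; ring.
have dE : disc E = 0 by rewrite /disc det2E !mxE /=; ring.
have dE' : disc E' = 0 by rewrite /disc det2E !mxE /=; ring.
exists (cell D), (cell E), (cell E'); split.
- apply: imset_f; rewrite inE TD dD oner_eq0; apply/issquareP; exists 1.
  exact: expr1n.
- by apply: imset_f; rewrite inE TE dE eqxx.
- by apply: imset_f; rewrite inE TE' dE' eqxx.
- apply/eqP => /(cell_proportional TE TE')[c _ /matrixP/(_ 1 0)].
  by rewrite !mxE /= mulr0; apply/eqP/oner_neq0.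
apply/subsetP => x Dx.
have [g Sg xE] := PSL_lift (subsetP (cell_subPSL D) _ Dx).
move: Dx; rewrite xE mem_cell // => Cg.
have [b gE] := centr_form TD Cg.
have g01 : GLval g 0 1 = 0 by rewrite gE !mxE /= mulr0n mulr0 addr0.
have g10 : GLval g 1 0 = 0 by rewrite gE !mxE /= mulr0n mulr0 addr0.
have dg := SL_det Sg; rewrite det2E g01 mul0r subr0 in dg.
have n0 : GLval g 0 0 != 0 by apply: contra_eqN dg => /eqP->; rewrite mul0r eq_sym oner_eq0.
have n1 : GLval g 1 1 != 0 by apply: contra_eqN dg => /eqP->; rewrite mulr0 eq_sym oner_eq0.
rewrite inE; apply/andP; split.
  (* For diagonal [g], the nonzero entries of [E *m g] and [g *m E] are the second and first
     diagonal entries of [g], whence this ratio; for [E'] it is inverted. *)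
  apply: (@mem_norm_cell _ _ (GLval g 1 1 / GLval g 0 0)) => //.
    by rewrite mulf_neq0 ?invr_neq0.
  by apply: mx2_eq; rewrite !mulmx2E !mxE /= ?g01 ?g10; field; rewrite ?n0 ?n1.
apply: (@mem_norm_cell _ _ (GLval g 0 0 / GLval g 1 1)) => //.
  by rewrite mulf_neq0 ?invr_neq0.
by apply: mx2_eq; rewrite !mulmx2E !mxE /= ?g01 ?g10; field; rewrite ?n0 ?n1.
Qed.

(** The square of [g] is a scalar [c], so Cayley-Hamilton gives [tr(g) g = c + 1]. A nonzero trace
    would make [g] scalar, hence central. *)
Lemma involution_lift g : g \in S -> #[coset Z g] = 2%N ->
  \tr (GLval g) = 0 /\ GLval g *m GLval g = - 1%:M.
Proof.
move=> Sg og; have CH := mx2_cayley (GLval g); rewrite (SL_det Sg) in CH.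
have nZ : g \notin Z by rewrite -coset_eq1 // -order_eq1 og.
have : (g ^+ 2)%g \in Z.
  by rewrite -(coset_eq1 (groupX 2 Sg)) (morphX _ 2 (SL_normZ Sg)) /= -order_dvdn og.
rewrite mem_center => /andP[_ /existsP[c /eqP gc]].
rewrite (_ : g ^+ 2 = g * g)%g // GLvalM CH in gc.
suff tg : \tr (GLval g) = 0 by rewrite CH tg scale0r sub0r.
apply/eqP/negPn/negP => nt; case/negP: nZ; rewrite mem_center Sg /=.
apply/existsP; exists ((c + 1) / \tr (GLval g)).
rewrite -(inj_eq (scalerI nt)) scale_scalar_mx mulrC divfK //.
by rewrite raddfD /= -gc subrK.
Qed.

(** The lifts [I] and [J] square to -1 and commute up to sign. If they commuted, [J] would be [I] or
    [- I] and the cosets equal; so they anticommute and [quaternion_rotator] applies. Halving [W],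
    of determinant 4, gives the lift of [y]. *)
Lemma klein_rotation_PSL e v : e \in PSL p -> v \in PSL p -> #[e]%g = 2%N -> #[v]%g = 2%N ->
  commute e v -> e != v -> exists y, [/\ y \in PSL p, (e ^ y = e * v)%g & (v ^ y = e)%g].
Proof.
case/PSL_lift => g Sg ->; case/PSL_lift => h Sh -> og oh cgh ngh.
have [tI II] := involution_lift Sg og; have [tJ JJ] := involution_lift Sh oh.
have dI := SL_det Sg; have dJ := SL_det Sh.
have [Ng Nh] := (SL_normZ Sg, SL_normZ Sh).
have JI : GLval h *m GLval g = - (GLval g *m GLval h).
  have : coset Z (g * h)%g == coset Z (h * g)%g by rewrite !morphM //; apply/eqP.
  rewrite coset_eq ?groupM // !GLvalM => /orP[/eqP E|/eqP->]; last by rewrite opprK.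
  have nI : GLval g != 0.
    by apply: contra_eqN dI => /eqP->; rewrite det0 eq_sym oner_eq0.
  have [b hE] := commute_trace0 two_neq0 tI nI (esym E).
  rewrite tJ mul0r raddf0 add0r in hE.
  have : b ^+ 2 == 1 by rewrite -dJ hE detZ dI mulr1.
  rewrite sqrf_eq1 => bE; case/negP: ngh; rewrite coset_eq // hE.
  by case/orP: bE => /eqP->; rewrite ?scale1r ?scaleN1r ?opprK eqxx ?orbT.
set I := GLval g in tI II dI JI; set J := GLval h in tJ JJ dJ JI.
have [WI IW dW] := quaternion_rotator two_neq0 tI tJ II JJ JI erefl.
move: (1%:M + _) WI IW dW => W WI IW dW.
have two := two_neq0.
have dY : \det (2^-1 *: W) = 1 by rewrite detZ dW; field.
pose y := GLof (2^-1 *: W); have Sy : y \in S := GLof_SL dY.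
have Ny := SL_normZ Sy.
have conjE (u w : {'GL_2(p)}) : u \in S -> w \in S ->
    GLval u *m W = W *m GLval w -> (coset Z u ^ coset Z y = coset Z w)%g.
  move=> Su Sw uW; rewrite -morphJ ?SL_normZ //; congr (coset Z _).
  apply: (mulgI y); rewrite conjgE mulKVg; apply: GLval_inj.
  by rewrite !GLvalM GLofK // -scalemxAr -scalemxAl uW.
exists (coset Z y); split; first exact: coset_PSL.
  by rewrite -morphM //; apply: conjE; rewrite ?groupM // GLvalM.
by apply: conjE.
Qed.

Lemma card_Solv_PSL : #|Solv (PSL p)| =
  (1 + p.+1 + #|splits| * torus_count p.-1./2 + #|nonsplits| * torus_count p.+1./2)%N.
Proof.
apply: (@card_Solv_partitioned _ (PSL p) p unips splits nonsplits).
- exact: p_pr.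
- exact: p_gt7.
- by move=> C /cell_typesP[M _ ->]; apply: cell_subPSL.
- move=> x Gx nx; have [M TM Mx] := cell_cover_PSL Gx nx.
  by exists (cell M) => //; apply: cell_types.
- move=> C D x /cell_typesP[M TM ->] /cell_typesP[M' TM' ->]; exact: cell_TI_PSL.
- by move=> C g; apply: (@cell_imset_conj (fun d => d == 0)).
- by move=> C g; apply: (@cell_imset_conj (fun d => (d != 0) && issquare d)).
- by move=> C g; apply: (@cell_imset_conj (fun d => ~~ issquare d)).
- move=> C /imsetP[M]; rewrite inE => /andP[TM /eqP d0] ->.
  by apply/eqP; rewrite -(eqn_pmul2r (ltn0Sn 1)) card_cell card_centr_unip // mulnC.
- move=> C /imsetP[M]; rewrite inE => /and3P[TM nd sq] ->.
  by rewrite card_cell card_centr_split.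
- move=> C /imsetP[M]; rewrite inE => /andP[TM ns] ->.
  by rewrite card_cell card_centr_nonsplit.
- exact: card_unips.
- exact: card_splits.
- exact: card_nonsplits.
- exact: torus_cyclic_PSL.
- by move=> T g TT; apply: torus_norm_PSL.
- exact: borel_ex_PSL.
- exact: klein_rotation_PSL.
Qed.

(** * Reduction modulo 24 *)

Lemma torus_count_mod12 k c : torus_count (12 * k + c) = torus_count c.
Proof.
have dv d : (d %| 12)%N -> (d %| 12 * k + c)%N = (d %| c)%N.
  by move=> d12; rewrite dvdn_addr // dvdn_mulr.
by rewrite /torus_count !dv.
Qed.

(** The residue of [p] modulo 24 fixes [(p - 1)/2] and [(p + 1)/2] modulo 12, and 2, 3 and 4 all
    divide 12. *)
Lemma card_Solv_PSL_mod24 r : (p %% 24 = r)%N ->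
  let N : rat := #|Solv (PSL p)|%:R in let q : rat := p%:R in
  N = q + 2 + q * (q + 1) / 2 * (torus_count r.-1./2)%:R
            + q * (q - 1) / 2 * (torus_count r.+1./2)%:R.
Proof.
move=> pr N q.
have op : odd p by case: (even_prime p_pr) => // E; move: p_gt7; rewrite E.
have or : odd r by rewrite -pr; move: op; clear; lia.
have pE : p = (12 * (p %/ 24) * 2 + r)%N by rewrite -pr; clear; lia.
have hS : p.-1./2 = (12 * (p %/ 24) + r.-1./2)%N by move: pE or; clear; lia.
have hN : p.+1./2 = (12 * (p %/ 24) + r.+1./2)%N by move: pE or; clear; lia.
have := card_Solv_PSL; rewrite hS hN !torus_count_mod12.
move: (torus_count _) (torus_count _) => s t E.
have nS : (#|splits|%:R : rat) = q * (q + 1) / 2.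
  have := congr1 (fun n : nat => n%:R : rat) card_splits.
  by rewrite !natrM -(natr1 p) -/q => <-; field.
have nN : (#|nonsplits|%:R : rat) = q * (q - 1) / 2.
  have := congr1 (fun n : nat => n%:R : rat) card_nonsplits.
  have pm : (p.-1%:R : rat) = q - 1 by rewrite -subn1 natrB // prime_gt0.
  by rewrite !natrM pm -/q => <-; field.
by rewrite /N E !natrD !natrM nS nN -(natr1 p) -/q; ring.
Qed.

End PSL2.

Local Open Scope ring_scope.

Theorem theorem3p10 (p : nat) :
  prime p -> (7 < p)%N -> (p %% 5 = 2 \/ p %% 5 = 3)%N ->
  let N : rat := (#|Solv (PSL p)|)%:R in
  let q : rat := p%:R in
  ((p %% 24 = 1)%N -> N = (5 / 2) * q ^+ 2 + (5 / 2) * q + 2) /\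
  ((p %% 24 = 5)%N -> N = 2 * q ^+ 2 + q + 2) /\
  ((p %% 24 = 7)%N -> N = (5 / 2) * q ^+ 2 + (1 / 2) * q + 2) /\
  ((p %% 24 = 11)%N -> N = 2 * q ^+ 2 + 2) /\
  ((p %% 24 = 13)%N -> N = 2 * q ^+ 2 + 2 * q + 2) /\
  ((p %% 24 = 17)%N -> N = (5 / 2) * q ^+ 2 + (3 / 2) * q + 2) /\
  ((p %% 24 = 19)%N -> N = 2 * q ^+ 2 + q + 2) /\
  ((p %% 24 = 23)%N -> N = (5 / 2) * q ^+ 2 - (1 / 2) * q + 2).
Proof.
move=> p_pr p_gt7 _ N q.
have H r (pr : (p %% 24 = r)%N) := card_Solv_PSL_mod24 p_pr p_gt7 pr.
(* Only small values of [torus_count] remain. For [r = 1] it is evaluated at 0, which every integer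
   divides, and yields 4 as for any multiple of 12. *)
by do 7?split; move=> /H E; rewrite [LHS]E -/q /torus_count /=; field.
Qed.
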